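(* There exist a sequence $V_n=(a_n,b_n)\in C^\infty(\overline{D},\mathbb{R}^2)$, $n\in\mathbb{N}$, and a constant $C<\infty$ with $\|\nabla V_n\|_{L^{2,1}(D)}\le C$ for all $n$, with the following property: if $u_n\in W^{1,1}(D)$ are solutions of the Neumann problem $$-\Delta u_n=f_n\ \text{ in } D,\qquad \frac{\partial u_n}{\partial\nu}=-\frac{1}{2\pi}\int_D f_n\ \text{ on }\partial D,$$ with $f_n=\det(\nabla V_n)$, then $$\|u_n\|_{L^\infty(D)}\to+\infty\quad\text{and}\quad \|\nabla u_n\|_{L^2(D)}\to+\infty\qquad\text{as } n\to\infty.$$
   Context: $D\subset\mathbb{R}^2$ is the open unit disc and $\nu$ is its outer unit normal. For $f\in L^1(D)$, a function $u\in W^{1,1}(D)$ is a solution of the Neumann problem $-\Delta u=f$ in $D$, $\frac{\partial u}{\partial \nu}=-\frac1{2\pi}\int_D f$ on $\partial D$, if $$-\frac{1}{2\pi}\int_D f\,\int_{\partial D}\psi=\int_D \nabla u\cdot\nabla\psi-f\psi\qquad\text{for all }\psi\in C^1(\overline{D}).$$ Such solutions are unique up to an additive constant. For a measurable function $g$ on $D$, let $\mu_g(t)=|\{z\in D: |g(z)|>t\}|$. The Lorentz norm is $\|g\|_{L^{2,1}(D)}=2\int_0^\infty \mu_g(t)^{1/2}\,dt$ (for vector- or matrix-valued $g$, $|g|$ is the Euclidean norm). *)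

(* Defs.v *)
(* Based on MathComp-Analysis. *)
From HB Require Import structures.
From mathcomp Require Import all_boot all_order all_algebra.
From mathcomp Require Import all_classical all_reals all_analysis.

Set Implicit Arguments.
Unset Strict Implicit.
Unset Printing Implicit Defensive.

Import Order.TTheory GRing.Theory Num.Theory numFieldNormedType.Exports.
Local Open Scope classical_set_scope.
Local Open Scope ring_scope.

Section Defs.
Context {R : realType}.

(* Points of the plane are pairs, the type that carries both the product
   measure and the product topology; values of planar vector fields and of
   gradients are row vectors. *)

Definition leb2 := (@lebesgue_measure R \x @lebesgue_measure R)%E.

Definition disc : set (R * R) := [set z | z.1 ^+ 2 + z.2 ^+ 2 < 1].

Definition cdisc : set (R * R) := [set z | z.1 ^+ 2 + z.2 ^+ 2 <= 1].

Definition basis2 (j : 'I_2) : R * R := if j == 0 then (1, 0) else (0, 1).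

(* [Ck_cdisc k f]: f is of class C^k on the open disc, and f and all its
   partial derivatives of order at most k extend continuously to the closed
   disc. The values of f on the unit circle are those of the extension; its
   values outside the closed disc are irrelevant. *)
Fixpoint Ck_cdisc (k : nat) (f : R * R -> R) : Prop :=
  {within cdisc, continuous f} /\
  if k is k'.+1 then
    forall j : 'I_2, exists2 g : R * R -> R, Ck_cdisc k' g &
      forall z, disc z -> is_derive z (basis2 j) f (g z)
  else True.

Definition Cinf_cdisc (f : R * R -> R) : Prop := forall k, Ck_cdisc k f.

Definition test_function (phi : R * R -> R) : Prop :=
  Cinf_cdisc phi /\
  exists K : set (R * R),
    [/\ compact K, K `<=` disc & forall z, ~ K z -> phi z = 0].

Definition grad (f : R * R -> R) (z : R * R) : 'rV[R]_2 :=
  \row_j 'D_(basis2 j) f z.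

Definition jacobian2 (V : R * R -> 'rV[R]_2) (z : R * R) : 'M[R]_2 :=
  \matrix_(i, j) 'D_(basis2 j) (fun w => V w 0 i) z.

Definition dotv (x y : 'rV[R]_2) : R := \sum_j x 0 j * y 0 j.

Definition enorm (m n : nat) (A : 'M[R]_(m, n)) : R :=
  Num.sqrt (\sum_i \sum_j A i j ^+ 2).

Definition L1_disc (f : R * R -> R) : Prop :=
  leb2.-integrable disc (EFin \o f).

Definition is_weak_grad (u : R * R -> R) (G : R * R -> 'rV[R]_2) : Prop :=
  forall j : 'I_2, L1_disc (fun z => G z 0 j) /\
    forall phi, test_function phi ->
      \int[leb2]_(z in disc) (u z * grad phi z 0 j) =
      - \int[leb2]_(z in disc) (G z 0 j * phi z).

Definition W11_disc (u : R * R -> R) : Prop :=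
  L1_disc u /\ exists G, is_weak_grad u G.

(* A representative of the weak gradient, which is unique up to a null set;
   0 when u has no weak gradient in L^1. *)
Definition weak_grad (u : R * R -> R) : R * R -> 'rV[R]_2 :=
  xget (fun=> 0) [set G | is_weak_grad u G].

Definition circle_integral (psi : R * R -> R) : R :=
  \int[lebesgue_measure]_(t in `[0, 2 * pi]) psi (cos t, sin t).

(* Meant for f in L^1(disc). *)
Definition neumann_solution (f u : R * R -> R) : Prop :=
  W11_disc u /\
  forall psi, Ck_cdisc 1 psi ->
    - (2 * pi)^-1 * (\int[leb2]_(z in disc) f z) * circle_integral psi =
    \int[leb2]_(z in disc) (dotv (weak_grad u z) (grad psi z) - f z * psi z).

Definition distribution_fun (g : R * R -> R) (t : R) : \bar R :=
  leb2 (disc `&` [set z | t < `|g z|]).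

Definition lorentz21 (g : R * R -> R) : \bar R :=
  (2%:E * \int[lebesgue_measure]_(t in `[0%R, +oo[)
            (distribution_fun g t `^ 2^-1))%E.

(* Extension by 0 outside the disc turns norms over the plane into norms
   over the disc. *)
Definition Lp_disc (p : \bar R) (g : R * R -> R) : \bar R :=
  Lnorm leb2 p (EFin \o (g \_ disc)).

End Defs.

(* Main.v *)
Require Import Defs.
From HB Require Import structures.
From mathcomp Require Import all_boot all_order all_algebra.
From mathcomp Require Import all_classical all_reals all_analysis.
From mathcomp Require Import measurable_realfun ess_sup_inf ring lra.
Import Order.TTheory GRing.Theory Num.Theory numFieldNormedType.Exports.
Set Implicit Arguments.
Unset Strict Implicit.
Unset Printing Implicit Defensive.
Local Open Scope classical_set_scope.
Local Open Scope ring_scope.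

(** The Lorentz norm of a gradient in the plane is invariant under dilations. Let
    V_n be one fixed map dilated by 2^n about the boundary point p = (0, 1). Its
    gradient is bounded in L^(2,1) ([lorentz_bump]), while det (grad V_n) is
    nonnegative on the disc and keeps a mass bounded from below as it concentrates
    at p. Over the whole plane this Jacobian has integral 0, so that no mass would
    remain at an interior point; at p half of the plane is cut away. So u_n looks
    like a multiple of the Neumann function with pole p, which is neither bounded
    nor of finite energy.

    The proof is by duality. Test the equation with the dipole
      psi_n = ln (P_+ / P_-),  P_± = (1 + 4^-n) (1 + |z|^2) ± 2 y,
    a truncation at scale 2^-n of twice the logarithm of |z + p| / |z - p|. It is
    odd in y, so its mean on the circle is 0 ([circle_integral_dipole]) and the
    equation gives ([neumann_flux])
      int grad u_n . grad psi_n = int det (grad V_n) psi_n.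
    The right-hand side grows at least like n, since psi_n >= n - 6 on a square where
    det (grad V_n) has mass bounded from below ([integral_density_dipole_ge]).

    Energy: the integral of |grad psi_n|^2 is only of order n
    ([integral_grad_dipole]), so by the inequality of arithmetic and geometric
    means the integral of |grad u_n|^2 grows at least linearly in n
    ([source_energy_bound]).

    Supremum: the Laplacian of psi_n is bounded in L^1 ([integral_lap_dipole]) and
    its normal derivative on the circle is 0, since psi_n is invariant under
    inversion. Integration by parts then bounds the left-hand side by
    |u_n|_oo times a constant ([weak_flux_le], [source_sup_bound]). As u_n has
    only a weak gradient, this integration by parts goes through the compactly
    supported cutoffs flat 0 ((k + 1) (1 - |z|^2) - 1).

    All planar integrals are estimated by comparison with step functions on
    dyadic squares centred at (0, ± 1) ([dyadic_integral], [dyadic_lorentz]). *)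

(** * Calculus of directional derivatives *)
Section DirectionalDerivatives.
Context {R : realType}.
Implicit Types (f g : R * R -> R) (h : R -> R) (z v : R * R).

(** Directional derivatives in the plane become derivatives on the line, to which
    the one-dimensional chain rule applies. *)
Lemma is_derive_line f z v d :
  is_derive z v f d <-> is_derive (0 : R) 1 (fun t => f (t *: v + z)) d.
Proof.
have E : (fun h : R => h^-1 *: ((f \o shift z) (h *: v) - f z)) =
         (fun h : R => h^-1 *: (((fun t => f (t *: v + z)) \o shift 0) (h *: (1:R))
           - f (0 *: v + z))).
  by rewrite funeqE => t /=; rewrite addr0 scale0r add0r [_%:A]mulr1.
by split=> -[df dE]; split; move: df dE; rewrite /derivable /derive E.
Qed.

Lemma is_derive_chain h f z v a b :
  is_derive (f z) 1 h a -> is_derive z v f b ->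
  is_derive z v (fun w => h (f w)) (a * b).
Proof.
move=> dh /is_derive_line df; apply/is_derive_line.
apply: (@is_derive1_comp R h (fun t => f (t *: v + z))).
by rewrite scale0r add0r.
Qed.

Lemma is_derive_affine (c d : R) : is_derive (0 : R) 1 (fun t : R => t * c + d) c.
Proof.
apply: (is_derive_eq (is_deriveD (is_deriveM (is_derive_id (0:R) 1)
  (is_derive_cst c (0:R) 1)) (is_derive_cst d (0:R) 1))).
by rewrite /= /GRing.scale /= mul0r mulr1 add0r addr0.
Qed.

Lemma is_derive_fst z v : is_derive z v fst v.1.
Proof. apply/is_derive_line; exact: is_derive_affine. Qed.

Lemma is_derive_snd z v : is_derive z v snd v.2.
Proof. apply/is_derive_line; exact: is_derive_affine. Qed.

Lemma is_derive_const (c : R) z v : is_derive z v (fun=> c) 0.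
Proof. exact: is_derive_cst. Qed.

Lemma is_derive_add f g z v a b : is_derive z v f a -> is_derive z v g b ->
  is_derive z v (fun w => f w + g w) (a + b).
Proof. exact: is_deriveD. Qed.

Lemma is_derive_mul f g z v a b : is_derive z v f a -> is_derive z v g b ->
  is_derive z v (fun w => f w * g w) (a * g z + f z * b).
Proof.
move=> df dg; apply: (is_derive_eq (is_deriveM df dg)).
by rewrite /GRing.scale /= addrC mulrC.
Qed.

Lemma is_derive_inv f z v a : f z != 0 -> is_derive z v f a ->
  is_derive z v (fun w => (f w)^-1) (- a * (f z)^-1 * (f z)^-1).
Proof.
move=> f0 df.
have d1 : is_derive (f z) (1:R) (fun x => x^-1) (- (f z) ^- 2 *: 1).
  exact: (@is_deriveV R id).
apply: (is_derive_eq (is_derive_chain d1 df)).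
by rewrite /GRing.scale /= mulr1; field.
Qed.

Lemma is_derive_log f z v a : 0 < f z -> is_derive z v f a ->
  is_derive z v (fun w => ln (f w)) (a * (f z)^-1).
Proof.
move=> f0 df; apply: (is_derive_eq (is_derive_chain (is_derive1_ln f0) df)).
by rewrite mulrC.
Qed.

End DirectionalDerivatives.

(** * The flat function exp(-1/t) and its derivatives *)
Section Flat.
Context {R : realType}.

(** The powers t^-n make the family closed under derivation: [flat 0] is the
    classical smooth function exp(-1/t) vanishing on the negative half-line, and
    each of its derivatives is a combination of members of the family. *)
Definition flat (n : nat) (t : R) : R :=
  if 0 < t then t ^- n * expR (- t^-1) else 0.

Lemma flat_ge0 n t : 0 <= flat n t.
Proof.
by rewrite /flat; case: ifP => // t0; rewrite mulr_ge0 ?expR_ge0//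
  invr_ge0 exprn_ge0// ltW.
Qed.

(** The exponential beats t^-(n+2). The factor t^2 gives the derivative 0 at the
    origin. *)
Lemma flat_le n t : flat n t <= (n.+2)`!%:R * t ^+ 2.
Proof.
rewrite /flat; case: ifP => [t0|_]; last by rewrite mulr_ge0 ?sqr_ge0.
have ti : 0 <= t^-1 by rewrite invr_ge0 ltW.
have := expR_ge1Dxn n.+1 ti; set F := (_ `!%:R) => E.
have F0 : 0 < F by rewrite ltr0n fact_gt0.
rewrite expRN ler_pdivrMr ?expR_gt0//.
have {}E : t^-1 ^+ n.+2 / F <= expR t^-1 by rewrite (le_trans _ E)// lerDr.
apply: le_trans (ler_wpM2l _ E); last by rewrite mulr_ge0 ?sqr_ge0 ?ltW.
have t2 : t != 0 by rewrite gt_eqF.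
have tn : t ^+ n != 0 by rewrite expf_neq0.
rewrite le_eqVlt; apply/orP; left; apply/eqP.
rewrite exprVn -[n.+2]addn2 exprD; field.
by rewrite t2 tn gt_eqF.
Qed.

Lemma is_derive_flat n (t : R) :
  is_derive t 1 (flat n) (flat n.+2 t - n%:R * flat n.+1 t).
Proof.
have [t0|t0|->] := ltgtP t 0.
- apply: (@near_eq_is_derive _ _ _ (cst 0)).
    near=> s; rewrite /flat /= ifF//; apply/negbTE; rewrite -leNgt.
    by apply: ltW; near: s; exact: lt_nbhsl.
  by rewrite /flat !ifF ?mulr0 ?subr0; [exact: is_derive_cst|
    apply/negbTE; rewrite -leNgt ltW..].
- apply: (@near_eq_is_derive _ R^o R^o (fun s : R => s ^- n * expR (- s^-1) : R)).
    near=> s; rewrite /flat /= ifT//.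
    by near: s; exact: lt_nbhsr.
  have tn0 : t != 0 by rewrite gt_eqF.
  have d1 : is_derive t (1:R) (fun x => x^-1) (- t ^- 2 *: 1) by exact: (@is_deriveV R id).
  have d2 := is_deriveX n d1.
  have d3 : is_derive t (1:R) (fun x => - x^-1) (- (- t ^- 2 *: 1)) by exact: is_deriveN d1.
  have d4 := is_derive1_comp (is_derive_expR _) d3.
  have d5 := is_deriveM d2 d4.
  rewrite [X in is_derive _ _ X](_ : _ =
    ((fun x => x^-1) ^+ n : R -> R) * (expR \o (fun x => - x^-1))); last first.
    apply/funext => s; rewrite /= [in RHS]/GRing.mul /= exprfctE. by rewrite exprVn.
  apply: (is_derive_eq d5).
  rewrite /flat t0 /GRing.scale /= !mulr1 exprfctE /= opprK.
  rewrite -!exprVn; case: n {d2 d5} => [|n] /=.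
    by rewrite mul0r !mul0r subr0 expr0 mulr0 addr0 mul1r mulrC.
  rewrite !exprS. ring.
- have F0 : flat n 0 = 0 by rewrite /flat ltxx.
  have E0 : flat n.+2 0 - n%:R * flat n.+1 0 = 0 by rewrite /flat ltxx mulr0 subr0.
  rewrite E0.
  suff H : (fun h : R =>
      h^-1 *: ((flat n \o shift 0) (h *: (1:R)) - flat n 0)) @ 0^' --> (0:R).
    by split; [apply/cvg_ex; exists 0|exact: cvg_lim].
  set C := (n.+2)`!%:R : R.
  have CC : (fun h : R => C * `|h|) @ 0^' --> (0 : R).
    apply: cvg_within_filter.
    have : (fun h : R => C * `|h|) @ (0 : R) --> C * `|0 : R|.
      by apply: cvgM; [exact: cvg_cst|exact: cvg_norm].
    by rewrite normr0 mulr0.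
  apply/norm_cvg0P; apply: (squeeze_cvgr _ _ CC); last exact: cvg_cst.
  near=> h.
  rewrite normr_ge0 /= F0 subr0 addr0 /GRing.scale /= mulr1 normrM normfV.
  have h0 : h != 0 by near: h; exact: nbhs_dnbhs_neq.
  rewrite ler_pdivrMl ?normr_gt0// (ger0_norm (flat_ge0 _ _)).
  by rewrite (le_trans (flat_le n h))// [leRHS]mulrCA -expr2 real_normK ?num_real.
Unshelve. all: by end_near. Qed.

Lemma continuous_flat n : continuous (flat n).
Proof.
move=> t; apply: differentiable_continuous; apply/derivable1_diffP.
by case: (is_derive_flat n t).
Qed.

End Flat.

(** * A class of functions closed under partial derivatives *)
Section Smooth.
Context {R : realType}.

(** A syntactic class is enough here: it contains every function of the proof,
    and a partial derivative of a member is again a member, whence [Cinf_cdisc]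
    by induction on the order of differentiation. *)
Inductive smooth : (R * R -> R) -> Prop :=
| smooth_cst c : smooth (fun=> c)
| smooth_fst : smooth fst
| smooth_snd : smooth snd
| smooth_add f g : smooth f -> smooth g -> smooth (fun z => f z + g z)
| smooth_mul f g : smooth f -> smooth g -> smooth (fun z => f z * g z)
| smooth_inv f : smooth f -> (forall z, 0 < f z) -> smooth (fun z => (f z)^-1)
| smooth_ln f : smooth f -> (forall z, 0 < f z) -> smooth (fun z => ln (f z))
| smooth_flat n f : smooth f -> smooth (fun z => flat n (f z)).

Lemma smooth_continuous f : smooth f -> continuous f.
Proof.
elim=> [c|||{}f g _ cf _ cg|{}f g _ cf _ cg|{}f _ cf f0|{}f _ cf f0|n {}f _ cf] z.
- exact: cvg_cst.
- exact: cvg_fst.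
- exact: cvg_snd.
- exact: cvgD (cf z) (cg z).
- exact: cvgM (cf z) (cg z).
- by apply: cvgV (cf z); rewrite gt_eqF.
- by apply: (continuous_comp (cf z)); exact: continuous_ln.
- by apply: (continuous_comp (cf z)); exact: continuous_flat.
Qed.

Lemma smooth_derive v f : smooth f ->
  exists2 g, smooth g & forall z, is_derive z v f (g z).
Proof.
elim=> [c|||{}f g _ [f' sf' df] _ [g' sg' dg]|{}f g sf [f' sf' df] sg [g' sg' dg]|
  {}f sf [f' sf' df] f0|{}f sf [f' sf' df] f0|n {}f sf [f' sf' df]].
- by exists (fun=> 0); [exact: smooth_cst|move=> z; exact: is_derive_const].
- by exists (fun=> v.1); [exact: smooth_cst|move=> z; exact: is_derive_fst].
- by exists (fun=> v.2); [exact: smooth_cst|move=> z; exact: is_derive_snd].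
- exists (fun z => f' z + g' z); first exact: smooth_add.
  by move=> z; exact: is_derive_add.
- exists (fun z => f' z * g z + f z * g' z).
    by apply: smooth_add; exact: smooth_mul.
  by move=> z; exact: is_derive_mul.
- exists (fun z => (-1) * f' z * (f z)^-1 * (f z)^-1).
    do 2 (apply: smooth_mul; last exact: smooth_inv).
    by apply: smooth_mul => //; exact: smooth_cst.
  by move=> z; rewrite mulN1r; apply: is_derive_inv; rewrite ?gt_eqF.
- exists (fun z => f' z * (f z)^-1).
    by apply: smooth_mul => //; exact: smooth_inv.
  by move=> z; exact: is_derive_log.
- exists (fun z => (flat n.+2 (f z) + (- n%:R) * flat n.+1 (f z)) * f' z).
    apply: smooth_mul => //; apply: smooth_add; first exact: smooth_flat.
    by apply: smooth_mul; [exact: smooth_cst|exact: smooth_flat].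
  by move=> z; rewrite mulNr; apply: is_derive_chain => //; exact: is_derive_flat.
Qed.

Lemma smooth_Ck_cdisc k f : smooth f -> Ck_cdisc k f.
Proof.
elim: k f => [|k IH] f sf; (split; first by
  apply: continuous_subspaceT; exact: smooth_continuous) => // j.
by have [g sg dg] := smooth_derive (basis2 j) sf; exists g => //; exact: IH.
Qed.

End Smooth.

Section SmoothMore.
Context {R : realType}.
Implicit Types f g : R * R -> R.

Lemma smooth_sqr f : smooth f -> smooth (fun z => f z ^+ 2).
Proof. by move=> sf; exact: (smooth_mul sf sf). Qed.

Lemma smooth_scale c f : smooth f -> smooth (fun z => c * f z).
Proof. exact: (smooth_mul (smooth_cst c)). Qed.

Lemma smooth_opp f : smooth f -> smooth (fun z => - f z).
Proof. by move=> sf; under eq_fun do rewrite -mulN1r; exact: smooth_scale. Qed.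

Lemma smooth_sub f g : smooth f -> smooth g -> smooth (fun z => f z - g z).
Proof. by move=> sf sg; exact: smooth_add sf (smooth_opp sg). Qed.

Lemma is_derive_scale c f z v d : is_derive z v f d ->
  is_derive z v (fun w => c * f w) (c * d).
Proof.
move=> df; apply: (is_derive_eq (is_derive_mul (is_derive_const c z v) df)).
by rewrite mul0r add0r.
Qed.

Lemma is_derive_sqr f z v d : is_derive z v f d ->
  is_derive z v (fun w => f w ^+ 2) (2 * f z * d).
Proof.
by move=> df; apply: (is_derive_eq (is_derive_mul df df)); ring.
Qed.

Lemma is_derive_sub f g z v a b : is_derive z v f a -> is_derive z v g b ->
  is_derive z v (fun w => f w - g w) (a - b).
Proof. exact: is_deriveB. Qed.

Lemma is_derive_div f g z v a b : g z != 0 -> is_derive z v f a ->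
  is_derive z v g b ->
  is_derive z v (fun w => f w / g w) (a / g z - f z * b / g z ^+ 2).
Proof.
move=> g0 df dg; apply: (is_derive_eq (is_derive_mul df (is_derive_inv g0 dg))).
by field.
Qed.

End SmoothMore.

(** * The bump, the dipole and their derivatives *)
Section Potential.
Context {R : realType}.
Variable e : R.
Hypothesis e0 : 0 < e.
Implicit Types (z v : R * R) (s : R).

(** The square of the distance to the boundary point (0, 1), regularised at
    scale e. *)
Definition bump_denom z : R := z.1 ^+ 2 + (1 - z.2) ^+ 2 + e ^+ 2.

Lemma bump_denom_gt0 z : 0 < bump_denom z.
Proof. by rewrite ltr_wpDl ?exprn_gt0// addr_ge0 ?sqr_ge0. Qed.

Lemma smooth_bump_denom : smooth bump_denom.
Proof.
apply: (smooth_add _ (smooth_cst _)); apply: smooth_add; apply: smooth_sqr.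
  exact: smooth_fst.
exact: (smooth_sub (smooth_cst 1) smooth_snd).
Qed.

Lemma is_derive_bump_denom z v :
  is_derive z v bump_denom (2 * z.1 * v.1 - 2 * (1 - z.2) * v.2).
Proof.
apply: (is_derive_eq (is_derive_add (is_derive_add
  (is_derive_sqr (is_derive_fst z v))
  (is_derive_sqr (is_derive_sub (is_derive_const 1 z v) (is_derive_snd z v))))
  (is_derive_const (e ^+ 2) z v))).
by ring.
Qed.

(** In the variable (z - (0, 1)) / e this is a fixed map of the plane, so that
    scale-invariant norms of its gradient do not depend on e. The Jacobian
    determinant is nonnegative on the disc and concentrates at (0, 1), with total
    mass bounded from below. *)
Definition bump z : 'rV[R]_2 :=
  \row_j (if j == 0 then e * z.1 / bump_denom z else e ^+ 2 / bump_denom z).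

Lemma smooth_bump i : smooth (fun z => bump z 0 i).
Proof.
have sV c : smooth (fun z => c / bump_denom z).
  apply: smooth_scale; apply: smooth_inv; [exact: smooth_bump_denom|exact: bump_denom_gt0].
under eq_fun do rewrite mxE; case: (i == 0).
  apply: smooth_mul; last first.
    by apply: smooth_inv; [exact: smooth_bump_denom|exact: bump_denom_gt0].
  by apply: smooth_scale; exact: smooth_fst.
exact: sV.
Qed.

Lemma is_derive_bump0 z v : is_derive z v (fun w => bump w 0 0)
  (e * (v.1 / bump_denom z -
        z.1 * (2 * z.1 * v.1 - 2 * (1 - z.2) * v.2) / bump_denom z ^+ 2)).
Proof.
have c0 : bump_denom z != 0 by rewrite gt_eqF// bump_denom_gt0.
rewrite [X in is_derive _ _ X](_ : _ = fun w => e * w.1 / bump_denom w); last first.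
  by apply/funext => w; rewrite mxE.
apply: (is_derive_eq (is_derive_div c0 (is_derive_scale e (is_derive_fst z v))
  (is_derive_bump_denom z v))).
by field.
Qed.

Lemma is_derive_bump1 z v : is_derive z v (fun w => bump w 0 1)
  (- e ^+ 2 * (2 * z.1 * v.1 - 2 * (1 - z.2) * v.2) / bump_denom z ^+ 2).
Proof.
have c0 : bump_denom z != 0 by rewrite gt_eqF// bump_denom_gt0.
rewrite [X in is_derive _ _ X](_ : _ = fun w => e ^+ 2 / bump_denom w); last first.
  by apply/funext => w; rewrite mxE.
apply: (is_derive_eq (is_derive_div c0 (is_derive_const (e ^+ 2) z v)
  (is_derive_bump_denom z v))).
by field.
Qed.

Lemma jacobian_bumpE z : jacobian2 bump z = \matrix_(i, j)
  (if i == 0 then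
     if j == 0 then e * ((1 - z.2) ^+ 2 + e ^+ 2 - z.1 ^+ 2) / bump_denom z ^+ 2
     else 2 * e * z.1 * (1 - z.2) / bump_denom z ^+ 2
   else if j == 0 then - 2 * e ^+ 2 * z.1 / bump_denom z ^+ 2
     else 2 * e ^+ 2 * (1 - z.2) / bump_denom z ^+ 2).
Proof.
have c0 : bump_denom z != 0 by rewrite gt_eqF// bump_denom_gt0.
apply/matrixP => i j; rewrite !mxE.
have [->|/negPf i0] := eqVneq i 0.
  rewrite (@derive_val _ _ _ _ _ _ _ (is_derive_bump0 z (basis2 j))) /basis2.
  by case: (j == 0) => /=; move: c0; rewrite /bump_denom => c0; field.
have -> : i = 1 by apply/val_inj; case: i i0 => -[|[|]].
rewrite (@derive_val _ _ _ _ _ _ _ (is_derive_bump1 z (basis2 j))) /basis2.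
by case: (j == 0) => /=; field.
Qed.

Definition bump_density z := 2 * e ^+ 3 * (1 - z.2) / bump_denom z ^+ 3.

Lemma det_jacobian_bump z : \det (jacobian2 bump z) = bump_density z.
Proof.
have c0 : bump_denom z != 0 by rewrite gt_eqF// bump_denom_gt0.
rewrite jacobian_bumpE (expand_det_row _ 0) !big_ord_recl big_ord0.
rewrite /cofactor !det_mx11 !mxE /= /bump_density.
by move: c0; rewrite /bump_denom => c0; field.
Qed.

(** The squares of the entries add up to
    e^2 (M^2 + 4 e^2 (1 - y)^2) / M^4, where M is the denominator, and
    2 e (1 - y) <= M. *)
Lemma enorm_jacobian_bump z : enorm (jacobian2 bump z) <= 2 * e / bump_denom z.
Proof.
have c0 : bump_denom z != 0 by rewrite gt_eqF// bump_denom_gt0.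
have r0 : 0 <= 2 * e / bump_denom z by rewrite divr_ge0 ?mulr_ge0 ?ltW// bump_denom_gt0.
rewrite /enorm -[leRHS](ger0_norm r0) -sqrtr_sqr ler_wsqrtr//.
rewrite !big_ord_recl !big_ord0 jacobian_bumpE !mxE /= !addr0.
have H : (4 * e ^+ 2 * (1 - z.2) ^+ 2 <= bump_denom z ^+ 2).
  rewrite /bump_denom; have := sqr_ge0 ((1 - z.2) ^+ 2 - e ^+ 2).
  have := sqr_ge0 z.1; have := sqr_ge0 (1 - z.2); have := sqr_ge0 e.
  nra.
rewrite [leLHS](_ : _ = e ^+ 2 *
    (bump_denom z ^+ 2 + 4 * e ^+ 2 * (1 - z.2) ^+ 2) / bump_denom z ^+ 4); last first.
  by move: c0; rewrite /bump_denom => c0; field.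
rewrite [leRHS](_ : _ = e ^+ 2 * (4 * bump_denom z ^+ 2) / bump_denom z ^+ 4); last by field.
rewrite ler_pM2r ?invr_gt0 ?exprn_gt0 ?bump_denom_gt0// ler_pM2l ?exprn_gt0//.
by have := sqr_ge0 (bump_denom z); nra.
Qed.

Lemma bump_density_ge0 z : z.2 <= 1 -> 0 <= bump_density z.
Proof.
move=> z1; apply: divr_ge0; last by rewrite exprn_ge0 ?ltW ?bump_denom_gt0.
by rewrite mulr_ge0 ?subr_ge0// mulr_ge0 ?exprn_ge0 ?ltW.
Qed.

Lemma smooth_bump_density : smooth bump_density.
Proof.
have sc : smooth (fun z => (bump_denom z)^-1).
  by apply: smooth_inv; [exact: smooth_bump_denom|exact: bump_denom_gt0].
rewrite [X in smooth X](_ : _ = fun z => (2 * e ^+ 3 * (1 - z.2)) *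
    ((bump_denom z)^-1 * ((bump_denom z)^-1 * (bump_denom z)^-1))); last first.
  apply/funext => z; rewrite /bump_density; field.
  by rewrite gt_eqF// bump_denom_gt0.
apply: smooth_mul; last exact: (smooth_mul sc (smooth_mul sc sc)).
by apply: smooth_scale; exact: (smooth_sub (smooth_cst 1) smooth_snd).
Qed.

(** A regularisation of the square of the distance to (0, -s), such that the
    quotient by 1 + |z|^2 is invariant under the inversion z -> z / |z|^2. The
    normal derivative of that quotient on the unit circle is therefore 0. *)
Definition pole s z : R := (1 + e ^+ 2) * (z.1 ^+ 2 + z.2 ^+ 2 + 1) + 2 * s * z.2.

Lemma pole_ge s z : s ^+ 2 = 1 -> z.1 ^+ 2 + (z.2 + s) ^+ 2 + e ^+ 2 <= pole s z.
Proof.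
move=> s1; rewrite /pole.
have e2 := sqr_ge0 e; have x2 := sqr_ge0 z.1; have y2 := sqr_ge0 z.2.
rewrite [(z.2 + s) ^+ 2]sqrrD s1.
nra.
Qed.

Lemma pole_gt0 s z : s ^+ 2 = 1 -> 0 < pole s z.
Proof.
move=> s1; apply: lt_le_trans (pole_ge z s1).
by rewrite ltr_wpDl ?exprn_gt0// addr_ge0 ?sqr_ge0.
Qed.

Lemma smooth_pole s : smooth (pole s).
Proof.
apply: smooth_add; last exact: smooth_scale smooth_snd.
apply: smooth_scale; apply: (smooth_add _ (smooth_cst 1)).
by apply: smooth_add; apply: smooth_sqr; [exact: smooth_fst|exact: smooth_snd].
Qed.

Definition pole_der s v z : R :=
  2 * (1 + e ^+ 2) * (z.1 * v.1 + z.2 * v.2) + 2 * s * v.2.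

Lemma is_derive_pole s z v : is_derive z v (pole s) (pole_der s v z).
Proof.
apply: (is_derive_eq (is_derive_add (is_derive_scale (1 + e ^+ 2)
 (is_derive_add (is_derive_add (is_derive_sqr (is_derive_fst z v))
  (is_derive_sqr (is_derive_snd z v))) (is_derive_const 1 z v)))
  (is_derive_scale (2 * s) (is_derive_snd z v)))).
by rewrite /pole_der; ring.
Qed.

(** Up to a constant factor, this is the difference of the
    Neumann functions with poles (0, 1) and (0, -1), regularised at scale e. The
    common factors 1 + |z|^2 cancel in the difference, so that the normal
    derivative is 0 on the circle; and the function is odd in y, so that its mean
    on the circle is 0. *)
Definition dipole z : R := ln (pole 1 z) - ln (pole (-1) z).

Let s1 : (1 : R) ^+ 2 = 1. Proof. by rewrite expr1n. Qed.
Let sN1 : (-1 : R) ^+ 2 = 1. Proof. by rewrite sqrrN expr1n. Qed.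

Lemma smooth_dipole : smooth dipole.
Proof.
by apply: smooth_sub; apply: smooth_ln; do ?[exact: smooth_pole]; move=> z; exact: pole_gt0.
Qed.

Definition dipole_der v z : R :=
  pole_der 1 v z / pole 1 z - pole_der (-1) v z / pole (-1) z.

Lemma is_derive_dipole z v : is_derive z v dipole (dipole_der v z).
Proof.
by apply: is_derive_sub; (apply: is_derive_log; [exact: pole_gt0|exact: is_derive_pole]).
Qed.

Lemma smooth_pole_der s v : smooth (pole_der s v).
Proof.
apply: (smooth_add _ (smooth_cst _)); apply: smooth_scale.
apply: smooth_add; under eq_fun do rewrite mulrC; apply: smooth_scale.
  exact: smooth_fst.
exact: smooth_snd.
Qed.

Lemma smooth_dipole_der v : smooth (dipole_der v).
Proof.
apply: smooth_sub; (apply: smooth_mul; first exact: smooth_pole_der).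
  by apply: smooth_inv => [|z]; [exact: smooth_pole|exact: pole_gt0].
by apply: smooth_inv => [|z]; [exact: smooth_pole|exact: pole_gt0].
Qed.

Definition dipole_der2 v z : R :=
  let f s := (2 * (1 + e ^+ 2) * (v.1 ^+ 2 + v.2 ^+ 2)) / pole s z -
             pole_der s v z ^+ 2 / pole s z ^+ 2 in f 1 - f (-1).

Lemma is_derive_pole_der s z v : is_derive z v (pole_der s v)
  (2 * (1 + e ^+ 2) * (v.1 ^+ 2 + v.2 ^+ 2)).
Proof.
apply: (is_derive_eq (is_derive_add (is_derive_scale (2 * (1 + e ^+ 2))
  (is_derive_add (is_derive_mul (is_derive_fst z v) (is_derive_const v.1 z v))
    (is_derive_mul (is_derive_snd z v) (is_derive_const v.2 z v))))
  (is_derive_const _ z v))).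
by ring.
Qed.

Lemma is_derive_dipole_der z v : is_derive z v (dipole_der v) (dipole_der2 v z).
Proof.
have p1 : pole 1 z != 0 by rewrite gt_eqF// pole_gt0.
have p2 : pole (-1) z != 0 by rewrite gt_eqF// pole_gt0.
apply: (is_derive_eq (is_derive_sub
  (is_derive_div p1 (is_derive_pole_der 1 z v) (is_derive_pole 1 z v))
  (is_derive_div p2 (is_derive_pole_der (-1) z v) (is_derive_pole (-1) z v)))).
by rewrite /dipole_der2 !expr2.
Qed.

Lemma smooth_dipole_der2 v : smooth (dipole_der2 v).
Proof.
have H s : s ^+ 2 = 1 ->
    smooth (fun z => (2 * (1 + e ^+ 2) * (v.1 ^+ 2 + v.2 ^+ 2)) / pole s z -
                     pole_der s v z ^+ 2 / pole s z ^+ 2).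
  move=> ss; have ps z := pole_gt0 z ss.
  apply: smooth_sub.
    by apply: smooth_scale; apply: smooth_inv => //; exact: smooth_pole.
  apply: smooth_mul; first by apply: smooth_sqr; exact: smooth_pole_der.
  apply: smooth_inv => [|z]; last by rewrite exprn_gt0.
  by apply: smooth_sqr; exact: smooth_pole.
exact: smooth_sub (H _ s1) (H _ sN1).
Qed.

Lemma grad_dipole z j : grad dipole z 0 j = dipole_der (basis2 j) z.
Proof. by rewrite mxE (@derive_val _ _ _ _ _ _ _ (is_derive_dipole z (basis2 j))). Qed.

(** The logarithm of each pole is harmonic up to a term of order e^2 / pole^2,
    whose integral over the plane is bounded independently of e. *)
Lemma lap_dipole z : \sum_j dipole_der2 (basis2 j) z =
  4 * ((1 + e ^+ 2) ^+ 2 - 1) * (pole 1 z ^- 2 - pole (-1) z ^- 2).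
Proof.
have p1 : pole 1 z != 0 by rewrite gt_eqF// pole_gt0.
have p2 : pole (-1) z != 0 by rewrite gt_eqF// pole_gt0.
rewrite !big_ord_recl big_ord0 addr0 /dipole_der2 /pole_der /basis2 /=.
move: p1 p2; rewrite /pole; case: z => x y /=; rewrite mulr1 mulrN1 => p1 p2.
by field; rewrite p1 p2.
Qed.

(** The factor 1 - |z|^2 expresses that the normal derivative vanishes on the
    circle, in a quantitative form which survives multiplication by the gradient
    of a cutoff. *)
Lemma radial_dipole z : z.1 * dipole_der (basis2 0) z + z.2 * dipole_der (basis2 1) z =
  (1 - z.1 ^+ 2 - z.2 ^+ 2) * (1 + e ^+ 2) * ((pole (-1) z)^-1 - (pole 1 z)^-1).
Proof.
have p1 : pole 1 z != 0 by rewrite gt_eqF// pole_gt0.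
have p2 : pole (-1) z != 0 by rewrite gt_eqF// pole_gt0.
rewrite /dipole_der /pole_der /basis2 /=.
move: p1 p2; rewrite /pole; case: z => x y /=; rewrite mulr1 mulrN1 => p1 p2.
by field; rewrite p1 p2.
Qed.

(** For each pole P one has |grad P|^2 <= 4 (1 + e^2) P. *)
Lemma sqr_grad_dipole z : \sum_j grad dipole z 0 j ^+ 2 <=
  8 * (1 + e ^+ 2) * ((pole 1 z)^-1 + (pole (-1) z)^-1).
Proof.
rewrite !big_ord_recl big_ord0 addr0 !grad_dipole.
have H s : s ^+ 2 = 1 -> (pole_der s (basis2 0) z) ^+ 2 + pole_der s (basis2 1) z ^+ 2 <=
    4 * (1 + e ^+ 2) * pole s z.
  case: z => x y ss; rewrite /pole_der /pole /basis2 /=.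
  rewrite [leLHS](_ : _ = 4 * (1 + e ^+ 2) *
    ((1 + e ^+ 2) * (x ^+ 2 + y ^+ 2) + 2 * s * y) + 4 * s ^+ 2); last by ring.
  by rewrite ss; have := sqr_ge0 e; nra.
have K s : s ^+ 2 = 1 ->
    (pole_der s (basis2 0) z / pole s z) ^+ 2 +
    (pole_der s (basis2 1) z / pole s z) ^+ 2 <=
    4 * (1 + e ^+ 2) * (pole s z)^-1.
  move=> ss; have ps := pole_gt0 z ss.
  rewrite !expr_div_n -mulrDl ler_pdivrMr ?exprn_gt0// (le_trans (H _ ss))//.
  by rewrite expr2 !mulrA mulfVK// gt_eqF.
have := K _ s1; have := K _ sN1; rewrite /dipole_der.
set a := _ / pole (-1) z; set b := _ / pole (-1) z.
set c := _ / pole 1 z; set d := _ / pole 1 z.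
set p := _^-1; set q := _^-1 => H1 H2.
have := sqr_ge0 (a + c); have := sqr_ge0 (b + d).
by nra.
Qed.

Lemma dipole_odd x y : dipole (x, - y) = - dipole (x, y).
Proof.
rewrite /dipole [RHS]opprB /pole /= sqrrN; congr (ln _ - ln _); ring.
Qed.

End Potential.

(** * Measurability and integrability on the disc *)
Section MeasureOnDisc.
Context {R : realType}.
Local Notation R2 := (measurableTypeR R * measurableTypeR R)%type.
Implicit Types (f g : R * R -> R) (z : R * R).

Lemma smooth_measurable f (D : set R2) :
  smooth f -> measurable_fun D (f : R2 -> R).
Proof.
move=> sf; apply: (@measurable_funS _ _ _ _ setT) => //.
elim: sf => [c|||{}f g _ mf _ mg|{}f g _ mf _ mg|{}f sf mf f0|{}f _ mf f0|n {}f _ mf].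
- exact: measurable_cst.
- exact: measurable_fst.
- exact: measurable_snd.
- exact: measurable_funD.
- exact: measurable_funM.
- rewrite [X in measurable_fun _ X](_ : _ = fun z => expR (- ln (f z))); last first.
    by apply/funext => z; rewrite expRN lnK// posrE.
  apply: measurableT_comp; first exact: measurable_expR.
  by apply: measurable_funN; apply: measurableT_comp; first exact: measurable_ln.
- by apply: measurableT_comp; first exact: measurable_ln.
- apply: measurableT_comp => //.
  by apply: continuous_measurable_fun; exact: continuous_flat.
Qed.

Lemma smooth_radius : smooth (fun z : R * R => z.1 ^+ 2 + z.2 ^+ 2).
Proof. by apply: smooth_add; apply: smooth_sqr; [exact: smooth_fst|exact: smooth_snd]. Qed.

Lemma measurable_disc : measurable (disc : set R2).
Proof.
rewrite (_ : disc = setT `&`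
    (fun z : R * R => z.1 ^+ 2 + z.2 ^+ 2) @^-1` `]-oo, 1[%classic).
  by apply: (smooth_measurable smooth_radius) => //; exact: measurable_itv.
by rewrite setTI; apply/seteqP; split=> z; rewrite /disc /= in_itv.
Qed.

(** The square of half-side r with centre (0, s). *)
Definition box (s r : R) : set (R * R) := `[- r, r] `*` `[s - r, s + r].

Lemma boxE (s r : R) z : box s r z <-> (`|z.1| <= r) /\ (`|z.2 - s| <= r).
Proof.
rewrite /box /= !in_itv /= !ler_norml lerBrDr [z.2 - s <= _]lerBlDr.
by rewrite (addrC _ s) (addrC r).
Qed.

Lemma measurable_box (s r : R) : measurable (box s r : set R2).
Proof. exact: measurableX. Qed.

Lemma leb2_box (s r : R) : 0 <= r -> leb2 (box s r) = (4 * r ^+ 2)%:E.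
Proof.
move=> r0.
transitivity (lebesgue_measure `[(- r)%R, r]%classic *
  lebesgue_measure `[(s - r)%R, (s + r)%R]%classic)%E; first exact: product_measure1E.
rewrite !lebesgue_measure_itv/= !lte_fin.
move: r0; rewrite le_eqVlt => /orP[/eqP <-|r0].
  by rewrite oppr0 ltxx mul0e expr0n mulr0.
have -> : - r < r by lra.
have -> : s - r < s + r by lra.
by rewrite -!EFinB -EFinM; congr (_%:E); ring.
Qed.

Lemma norm_le1 (x : R) : x ^+ 2 <= 1 -> `|x| <= 1.
Proof.
by move=> x1; rewrite -(@ler_pXn2r _ 2)// ?nnegrE// real_normK ?num_real// expr1n.
Qed.

Lemma disc_subset_box (s : R) : `|s| <= 1 -> disc `<=` box s 2.
Proof.
move=> s1 z; rewrite /disc /= => zD; apply/boxE.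
have x2 := sqr_ge0 z.1; have y2 := sqr_ge0 z.2.
have x1 : `|z.1| <= 1 by apply: norm_le1; lra.
have y1 : `|z.2| <= 1 by apply: norm_le1; lra.
split; first by lra.
by rewrite (le_trans (ler_normB _ _))//; lra.
Qed.

Lemma leb2_disc_le : (leb2 (disc : set (R * R)) <= 16%:E)%E.
Proof.
apply: le_trans (_ : (leb2 (box 0 2) <= _)%E).
  apply: le_measure; rewrite ?inE; [exact: measurable_disc|exact: measurable_box|].
  by apply: disc_subset_box; rewrite normr0.
by rewrite leb2_box// lee_fin; lra.
Qed.

Lemma cdisc_compact : compact (cdisc : set (R * R)).
Proof.
apply: (@subclosed_compact _ _ (`[(-1 : R), 1]%classic `*` `[(-1 : R), 1]%classic)).
- rewrite (_ : cdisc = (fun z : R * R => z.1 ^+ 2 + z.2 ^+ 2) @^-1` [set x | x <= 1])//.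
  apply: preimage_closed; last exact: closed_le.
  by move=> z _; apply: (smooth_continuous smooth_radius).
- by apply: compact_setX; exact: segment_compact.
- move=> z; rewrite /cdisc /= => zD.
  have x2 := sqr_ge0 z.1; have y2 := sqr_ge0 z.2.
  by rewrite !in_itv /= -!ler_norml; split; apply: norm_le1; lra.
Qed.

Lemma disc_subset_cdisc : disc `<=` (cdisc : set (R * R)).
Proof. by move=> z /ltW. Qed.

Lemma smooth_bounded f : smooth f -> exists C : R, forall z, disc z -> `|f z| <= C.
Proof.
move=> sf.
have : compact (f @` cdisc).
  apply: continuous_compact; last exact: cdisc_compact.
  by apply: continuous_subspaceT; exact: smooth_continuous.
move=> /compact_bounded [M [_ /(_ (M + 1))]].
rewrite ltrDl => /(_ ltr01) H; exists (M + 1) => z /disc_subset_cdisc Dz.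
by apply: H; exists z.
Qed.

Lemma bounded_integrable_disc f C :
  measurable_fun (disc : set R2) f ->
  (forall z, disc z -> `|f z| <= C) -> L1_disc f.
Proof.
move=> mf fC; apply: measurable_bounded_integrable => //.
- exact: measurable_disc.
- by apply: le_lt_trans leb2_disc_le _; rewrite ltry.
- by exists C; split; rewrite ?num_real// => x Cx z Dz; apply: le_trans (ltW Cx); exact: fC.
Qed.

Lemma smooth_integrable_disc f : smooth f -> L1_disc f.
Proof.
move=> sf; have [C fC] := smooth_bounded sf.
by apply: bounded_integrable_disc fC; exact: smooth_measurable.
Qed.

Lemma integrable_mul_bounded f g C : L1_disc f ->
  measurable_fun (disc : set R2) g ->
  (forall z, disc z -> `|g z| <= C) -> L1_disc (fun z => f z * g z).
Proof.
move=> fi mg gC; rewrite /L1_disc.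
apply: (integrableMl measurable_disc fi mg).
by exists C; split; rewrite ?num_real// => x Cx z Dz; apply: le_trans (ltW Cx); exact: gC.
Qed.

Lemma integrable_mul_smooth f g : L1_disc f -> smooth g -> L1_disc (fun z => f z * g z).
Proof.
move=> fi sg; have [C gC] := smooth_bounded sg.
by apply: integrable_mul_bounded gC => //; exact: smooth_measurable.
Qed.

End MeasureOnDisc.

(** * Integrals by dyadic boxes *)
Section Dyadic.
Context {R : realType}.
Local Notation R2 := (measurableTypeR R * measurableTypeR R)%type.
Implicit Types (g : R * R -> R) (z : R * R) (s : R).

Definition hpow k : R := 2^-1 ^+ k.

Lemma hpow_gt0 k : 0 < hpow k.
Proof. by rewrite exprn_gt0. Qed.

Definition dbox s k : set (R * R) := box s (2 * hpow k).

Lemma leb2_dbox s k : leb2 (dbox s k) = (16 * hpow k ^+ 2)%:E.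
Proof.
rewrite leb2_box; last by rewrite mulr_ge0 // ltW ?hpow_gt0.
by congr (_%:E); ring.
Qed.

Lemma notin_dbox s k z : ~ dbox s k.+1 z ->
  hpow k ^+ 2 <= z.1 ^+ 2 + (z.2 - s) ^+ 2.
Proof.
move=> H.
have x2 := sqr_ge0 z.1; have y2 := sqr_ge0 (z.2 - s); have hk := ltW (hpow_gt0 k).
have e : 2 * hpow k.+1 = hpow k by rewrite /hpow exprS mulrA divff// mul1r.
have {}H : (hpow k < `|z.1|) \/ (hpow k < `|z.2 - s|).
  have [h1|h1] := leP `|z.1| (hpow k); last by left.
  have [h2|h2] := leP `|z.2 - s| (hpow k); last by right.
  by case: H; apply/boxE; rewrite e.
case: H => /ltW H.
- apply: (@le_trans _ _ (`|z.1| ^+ 2)); first by rewrite lerXn2r ?nnegrE.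
  by rewrite real_normK ?num_real// lerDl.
- apply: (@le_trans _ _ (`|z.2 - s| ^+ 2)); first by rewrite lerXn2r ?nnegrE.
  by rewrite real_normK ?num_real// lerDr.
Qed.

(** The largest k <= n whose box contains z either is n or has z outside the next
    box. *)
Lemma dyadic_scale s n (P : nat -> R * R -> Prop) z : `|s| <= 1 -> disc z ->
  (forall k, (k < n)%N -> ~ dbox s k.+1 z -> P k z) -> P n z ->
  exists2 k, (k <= n)%N & dbox s k z /\ P k z.
Proof.
move=> s1 Dz HP Pn.
suff : forall m, (m <= n)%N -> (exists2 k, (k <= n)%N & dbox s k z /\ P k z) \/ dbox s m z.
  by move=> /(_ n (leqnn n))[//|dn]; exists n.
elim=> [_|m IH mn].
  by right; rewrite /dbox /hpow expr0 mulr1; exact: disc_subset_box.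
have [|dm] := IH (ltnW mn); first by left.
have [dm1|dm1] := pselect (dbox s m.+1 z); first by right.
by left; exists m; [exact: ltnW|split => //; exact: HP].
Qed.

(** By [dyadic_scale] the sum of the indicators of the boxes, with weights A k,
    dominates g. This replaces polar coordinates. *)
Lemma dyadic_integral s n g (A : nat -> R) : `|s| <= 1 ->
  measurable_fun (disc : set R2) g ->
  (forall z, disc z -> 0 <= g z) ->
  (forall k, 0 <= A k) ->
  (forall k z, (k < n)%N -> disc z -> ~ dbox s k.+1 z -> g z <= A k) ->
  (forall z, disc z -> g z <= A n) ->
  (\int[leb2]_(z in disc) (g z)%:E <= (\sum_(k < n.+1) A k * (16 * hpow k ^+ 2))%:E)%E.
Proof.
move=> s1 mg g0 A0 HA An.
have mB k : measurable_fun (disc : set R2)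
    (EFin \o (fun z => A k * \1_(dbox s k) z)).
  apply/measurable_EFinP; apply: measurable_funM => //.
  by apply: measurable_indic; exact: measurable_box.
have B0 k z : (0 <= (A k * \1_(dbox s k) z)%:E)%E.
  by rewrite lee_fin mulr_ge0// indicE ler0n.
apply: (@le_trans _ _ (\int[leb2]_(z in disc)
    (\sum_(k < n.+1) (A k * \1_(dbox s k) z)%:E))%E).
  apply: ge0_le_integral; first exact: measurable_disc.
  - by move=> z Dz; rewrite lee_fin g0.
  - exact/measurable_EFinP.
  - by apply: emeasurable_sum => k; exact: mB.
  - move=> z Dz.
    have [k kn [dk gk]] := @dyadic_scale s n (fun k z => g z <= A k) z s1 Dz
        (fun k kn nd => HA k z kn Dz nd) (An z Dz).
    rewrite (bigD1 (Ordinal (kn : (k < n.+1)%N)))//= indicE mem_set// mulr1.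
    rewrite -[leLHS]adde0; apply: leeD; first by rewrite lee_fin.
    by apply: sume_ge0 => i _.
rewrite (ge0_integral_sum _ measurable_disc)//; last by move=> k; exact: mB.
rewrite -sumEFin; apply: lee_sum => k _.
under eq_integral do rewrite EFinM.
rewrite ge0_integralZl_EFin//; last 2 first.
- exact: measurable_disc.
- by apply/measurable_EFinP; apply: measurable_indic; exact: measurable_box.
rewrite EFinM; apply: lee_wpmul2l; first by rewrite lee_fin.
rewrite integral_indic; [|exact: measurable_disc|exact: measurable_box].
rewrite -(leb2_dbox s); apply: le_measure; rewrite ?inE.
- by apply: measurableI; [exact: measurable_box|exact: measurable_disc].
- exact: measurable_box.
- exact: subIsetl.
Qed.


(** The integral of a nonnegative function is a supremum over the simple functions
    below it, hence monotone. This is applied to the integrand of the Lorentz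
    norm, a power of a distribution function. *)
Lemma ge0_le_integral_nonmeas d (T : measurableType d) (mu : {measure set T -> \bar R})
    (D : set T) (f1 f2 : T -> \bar R) :
  (forall x, D x -> 0 <= f1 x)%E -> (forall x, D x -> f1 x <= f2 x)%E ->
  (\int[mu]_(x in D) f1 x <= \int[mu]_(x in D) f2 x)%E.
Proof.
move=> f10 f12.
have f20 x : D x -> (0 <= f2 x)%E by move=> Dx; exact: le_trans (f10 x Dx) (f12 x Dx).
rewrite (ge0_integralE mu f10) (ge0_integralE mu f20).
apply: ge_ereal_sup => _ [h hf <-]; apply: ereal_sup_ubound; exists h => // x.
apply: le_trans (hf x) _; rewrite /patch; case: ifPn => // xD.
by apply: f12; rewrite inE in xD.
Qed.

Lemma sum_hpow_ratio n : \sum_(k < n.+1) hpow n / hpow k <= 2.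
Proof.
elim: n => [|n IH].
  by rewrite big_ord_recl big_ord0 /hpow expr0 divr1 addr0; lra.
rewrite big_ord_recr /= divff ?gt_eqF ?hpow_gt0//.
have -> : \sum_(i < n.+1) hpow n.+1 / hpow i = 2^-1 * \sum_(i < n.+1) hpow n / hpow i.
  by rewrite mulr_sumr; apply: eq_bigr => i _; rewrite [hpow n.+1]exprS mulrA.
by lra.
Qed.

(** For a level t, let k be least with t < A k. Then |g| > t only inside the k-th
    box, whose area has square root 4 * 2^-k. Hence mu(t)^(1/2) is at most the sum
    of 4 * 2^-k over the k with t < A k, and integrating in t gives the bound. *)
Lemma dyadic_lorentz s n g (A : nat -> R) : `|s| <= 1 ->
  (forall k, 0 <= A k) ->
  (forall k z, (k < n)%N -> disc z -> ~ dbox s k.+1 z -> `|g z| <= A k) ->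
  (forall z, disc z -> `|g z| <= A n) ->
  measurable_fun (disc : set R2) g ->
  (lorentz21 g <= (2 * \sum_(k < n.+1) A k * (4 * hpow k))%:E)%E.
Proof.
move=> s1 A0 HA An mg; rewrite /lorentz21 EFinM.
apply: lee_wpmul2l; first by rewrite lee_fin.
have mB k : measurable_fun (`[0, +oo[%classic : set (measurableTypeR R))
    (EFin \o (fun t => 4 * hpow k * \1_(`[0, A k[%classic) t)).
  by apply/measurable_EFinP; apply: measurable_funM.
have B0 k t : (0 <= (4 * hpow k * \1_(`[0, A k[%classic) t)%:E)%E.
  by rewrite lee_fin !mulr_ge0// ?indicE ?ler0n// ltW// hpow_gt0.
apply: (@le_trans _ _ (\int[lebesgue_measure]_(t in `[0%R, +oo[)
    (\sum_(k < n.+1) (4 * hpow k * \1_(`[0, A k[%classic) t)%:E))%E).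
  apply: ge0_le_integral_nonmeas => t; first by rewrite poweR_ge0.
  rewrite /= in_itv /= andbT => t0.
  have [Ant|tAn] := leP (A n) t.
    rewrite [X in (X `^ _)%E](_ : _ = 0%E).
      by rewrite poweR0r ?invr_neq0//; apply: sume_ge0 => k _; exact: B0.
    rewrite /distribution_fun (_ : _ `&` _ = set0) ?measure0//.
    apply/seteqP; split => // z [Dz]; rewrite /=.
    by rewrite ltNge (le_trans (An _ Dz) Ant).
  have [k tAk kmin] := ex_minnP (ex_intro (fun k => t < A k) n tAn).
  have kn : (k <= n)%N by exact: kmin.
  rewrite (bigD1 (Ordinal (kn : (k < n.+1)%N)))//= indicE mem_set ?mulr1; last first.
    by rewrite /= in_itv /= t0.
  rewrite -[leLHS]adde0; apply: leeD; last by apply: sume_ge0 => i _; exact: B0.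
  have -> : (4 * hpow k)%:E = ((16 * hpow k ^+ 2)%:E `^ 2^-1)%E.
    have -> : 16 * hpow k ^+ 2 = (4 * hpow k) ^+ 2 by ring.
    rewrite poweR_EFin -powR_mulrn ?mulr_ge0 ?ltW ?hpow_gt0//.
    by rewrite -powRrM divff// powRr1// ?mulr_ge0 ?ltW ?hpow_gt0.
  have sub : disc `&` [set z | t < `|g z|] `<=` dbox s k.
    move=> z [Dz /= tz]; apply: contrapT => nk.
    case: k kn kmin nk {tAk} => [|k] kn kmin nk.
      by apply: nk; rewrite /dbox /hpow expr0 mulr1; exact: disc_subset_box.
    have := HA k z kn Dz nk; rewrite leNgt => /negP; apply.
    apply: le_lt_trans tz; rewrite leNgt; apply/negP => tk.
    by have := kmin _ tk; rewrite ltnn.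
  have m1 : measurable (disc `&` [set z | t < `|g z|] : set R2).
    rewrite (_ : [set z | _] = (fun z => `|g z|) @^-1` `]t, +oo[%classic); last first.
      by apply/seteqP; split=> z; rewrite /= in_itv /= andbT.
    have mn : measurable_fun (disc : set R2) (fun z => `|g z|).
      by exact: measurableT_comp.
    by apply: mn => //; exact: measurable_disc.
  rewrite /distribution_fun; apply: gt0_ler_poweR => //.
  - by rewrite in_itv /= leey andbT.
  - by rewrite in_itv /= leey andbT lee_fin mulr_ge0 ?sqr_ge0.
  - rewrite -(leb2_dbox s); apply: le_measure; rewrite ?inE//.
    exact: measurable_box.
rewrite (ge0_integral_sum _ _)//; last by move=> k; exact: mB.
rewrite -sumEFin; apply: lee_sum => k _.
under eq_integral do rewrite EFinM.
rewrite ge0_integralZl_EFin//; last 2 first.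
- by apply/measurable_EFinP; exact: measurable_indic.
- by rewrite mulr_ge0// ltW// hpow_gt0.
rewrite [A k * _]mulrC [leRHS]EFinM; apply: lee_wpmul2l.
  by rewrite lee_fin mulr_ge0// ltW// hpow_gt0.
rewrite integral_indic//.
apply: (@le_trans _ _ (lebesgue_measure `[0, (A k)[%classic)).
  by apply: le_measure; rewrite ?inE//; exact: measurableI.
rewrite lebesgue_measure_itv /= lte_fin; case: ifP => _; rewrite ?lee_fin//.
by rewrite subr0.
Qed.

End Dyadic.

(** * Lorentz bound and integrals of inverse powers of the poles *)
Section Estimates.
Context {R : realType}.
Local Notation R2 := (measurableTypeR R * measurableTypeR R)%type.
Implicit Types (z : R * R) (n : nat).
Local Notation hpow := (@hpow R).

Lemma measurable_sqrt : measurable_fun setT (Num.sqrt : R -> R).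
Proof. by apply: continuous_measurable_fun; exact: sqrt_continuous. Qed.

Lemma measurable_enorm (p q : nat) (G : R * R -> 'M[R]_(p, q)) (D : set R2) :
  (forall i j, measurable_fun D (fun z : R2 => G z i j)) ->
  measurable_fun D (fun z : R2 => enorm (G z)).
Proof.
move=> mG; rewrite /enorm; apply: (measurableT_comp measurable_sqrt).
apply: measurable_sum => i; apply: measurable_sum => j.
by apply: measurable_funX; exact: mG.
Qed.

Lemma hpow_le1 n : hpow n <= 1.
Proof. by rewrite exprn_ile1// ?invf_le1// ler1n. Qed.

Lemma smooth_measurable_jacobian (V : R * R -> 'rV[R]_2) (D : set R2) i j :
  (forall i, smooth (fun z => V z 0 i)) ->
  measurable_fun D (fun z : R2 => jacobian2 V z i j).
Proof.
move=> sV; have [g sg dg] := smooth_derive (basis2 j) (sV i).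
under eq_fun do rewrite mxE (@derive_val _ _ _ _ _ _ _ (dg _)).
exact: smooth_measurable.
Qed.

(** Outside the (k + 1)-th box the gradient is at most 2 * 2^-n * 4^k; the
    dyadic sum is geometric, dominated by the scale of the bump. *)
Lemma lorentz_bump n :
  (lorentz21 (fun z => enorm (jacobian2 (bump (hpow n)) z)) <= 32%:E)%E.
Proof.
have hn := @hpow_gt0 R n.
have h2 k : 0 < hpow k ^+ 2 by rewrite exprn_gt0// hpow_gt0.
pose A k : R := 2 * hpow n / hpow k ^+ 2.
apply: le_trans (@dyadic_lorentz _ 1 n _ A _ _ _ _ _) _.
- by rewrite normr1.
- by move=> k; apply: divr_ge0; [rewrite mulr_ge0 ?ltW|rewrite ltW].
- move=> k z kn Dz /notin_dbox H; rewrite ger0_norm ?sqrtr_ge0//.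
  apply: le_trans (enorm_jacobian_bump hn z) _.
  rewrite ler_pM2l ?mulr_gt0// lef_pV2 ?posrE ?h2 ?bump_denom_gt0//.
  apply: le_trans H _; rewrite /bump_denom -(sqrrN (z.2 - 1)) opprB lerDl.
  by rewrite ltW.
- move=> z Dz; rewrite ger0_norm ?sqrtr_ge0//.
  apply: le_trans (enorm_jacobian_bump hn z) _.
  rewrite ler_pM2l ?mulr_gt0// lef_pV2 ?posrE ?h2 ?bump_denom_gt0//.
  by rewrite /bump_denom lerDr addr_ge0 ?sqr_ge0.
- apply: measurable_enorm => i j; apply: smooth_measurable_jacobian => k.
  exact: smooth_bump.
rewrite lee_fin.
have -> : \sum_(k < n.+1) A k * (4 * hpow k) = 8 * \sum_(k < n.+1) hpow n / hpow k.
  rewrite mulr_sumr; apply: eq_bigr => k _; rewrite /A; field.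
  by rewrite gt_eqF// hpow_gt0.
by have := @sum_hpow_ratio R n; lra.
Qed.

Lemma pole_dyadic n (s : R) k z : s ^+ 2 = 1 -> ~ dbox (- s) k.+1 z ->
  hpow k ^+ 2 <= pole (hpow n) s z.
Proof.
move=> s1 /notin_dbox; rewrite opprK => H.
apply: le_trans (pole_ge (hpow n) z s1); apply: le_trans H _.
by rewrite lerDl sqr_ge0.
Qed.

Lemma pole_ge_hpow n (s : R) z : s ^+ 2 = 1 -> hpow n ^+ 2 <= pole (hpow n) s z.
Proof.
move=> s1; apply: le_trans (pole_ge (hpow n) z s1).
by rewrite lerDr addr_ge0 ?sqr_ge0.
Qed.

Lemma smooth_pole_inv n (s : R) : s ^+ 2 = 1 ->
  smooth (fun z => (pole (hpow n) s z)^-1).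
Proof.
move=> s1; apply: smooth_inv => [|z]; first exact: smooth_pole.
exact: (pole_gt0 (hpow_gt0 n) z s1).
Qed.

Lemma norm_unit_le (s : R) : s ^+ 2 = 1 -> `|- s| <= 1.
Proof.
by move=> s1; rewrite normrN; apply: norm_le1; rewrite s1.
Qed.

(** All n + 1 scales contribute equally: the gradient of the dipole has energy of
    order n, the logarithm of the inverse scale. *)
Lemma integral_pole_inv n (s : R) : s ^+ 2 = 1 ->
  (\int[leb2]_(z in disc) ((pole (hpow n) s z)^-1)%:E <= (16 * n.+1%:R)%:E)%E.
Proof.
move=> s1; have p0 z := pole_gt0 (hpow_gt0 n) z s1.
have h2 k : 0 < hpow k ^+ 2 by rewrite exprn_gt0// hpow_gt0.
apply: le_trans (@dyadic_integral _ (- s) n _ (fun k => (hpow k ^+ 2)^-1) _ _ _ _ _ _) _.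
- exact: norm_unit_le.
- by apply: smooth_measurable; exact: smooth_pole_inv.
- by move=> z _; rewrite invr_ge0 ltW.
- by move=> k; rewrite invr_ge0 ltW.
- by move=> k z kn Dz nb; rewrite lef_pV2 ?posrE//; exact: pole_dyadic.
- by move=> z Dz; rewrite lef_pV2 ?posrE//; exact: pole_ge_hpow.
rewrite lee_fin (eq_bigr (fun=> 16)); last first.
  by move=> k _; rewrite mulrCA mulVf ?mulr1// gt_eqF.
by rewrite sumr_const card_ord mulr_natr.
Qed.

Lemma sum_hpow_ratio2 n : \sum_(k < n.+1) (hpow n / hpow k) ^+ 2 <= 2.
Proof.
apply: le_trans (@sum_hpow_ratio R n); apply: ler_sum => k _.
have h0 : 0 <= hpow n / hpow k by rewrite divr_ge0// ltW// hpow_gt0.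
rewrite expr2 ler_piMl// ler_pdivrMr ?hpow_gt0// mul1r.
have -> : hpow n = hpow (n - k) * hpow k by rewrite /hpow -exprD subnK// -ltnS.
by rewrite ler_piMl ?hpow_le1// ltW// hpow_gt0.
Qed.

(** The smallest scale dominates, which compensates the factor 4^-n. *)
Lemma integral_pole_inv2 n (s : R) : s ^+ 2 = 1 ->
  (\int[leb2]_(z in disc) (hpow n ^+ 2 * (pole (hpow n) s z)^-1 ^+ 2)%:E <= 32%:E)%E.
Proof.
move=> s1; have p0 z := pole_gt0 (hpow_gt0 n) z s1.
have h2 k : 0 < hpow k ^+ 2 by rewrite exprn_gt0// hpow_gt0.
have K x y : 0 < x -> x <= y -> y^-1 ^+ 2 <= x^-1 ^+ 2 :> R.
  move=> x0 xy; have y0 := lt_le_trans x0 xy.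
  by rewrite ler_pXn2r ?nnegrE ?invr_ge0 ?(ltW x0) ?(ltW y0)// lef_pV2.
apply: le_trans (@dyadic_integral _ (- s) n _
  (fun k => hpow n ^+ 2 * (hpow k ^+ 2)^-1 ^+ 2) _ _ _ _ _ _) _.
- exact: norm_unit_le.
- apply: smooth_measurable; apply: smooth_scale; apply: smooth_sqr.
  exact: smooth_pole_inv.
- by move=> z _; rewrite mulr_ge0 ?sqr_ge0.
- by move=> k; rewrite mulr_ge0 ?sqr_ge0.
- by move=> k z kn Dz nb; rewrite ler_pM2l// K//; exact: pole_dyadic.
- by move=> z Dz; rewrite ler_pM2l// K//; exact: pole_ge_hpow.
rewrite lee_fin (eq_bigr (fun k : 'I_n.+1 => 16 * (hpow n / hpow k) ^+ 2)); last first.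
  move=> k _; field.
  by rewrite gt_eqF// hpow_gt0.
by rewrite -mulr_sumr; have := sum_hpow_ratio2 n; lra.
Qed.

End Estimates.

(** * Lower bound on the pairing of the bump with the dipole *)
Section LowerBound.
Context {R : realType}.
Local Notation R2 := (measurableTypeR R * measurableTypeR R)%type.
Implicit Types (z : R * R) (n : nat).

Let s1 : (1 : R) ^+ 2 = 1. Proof. by rewrite expr1n. Qed.
Let sN1 : (-1 : R) ^+ 2 = 1. Proof. by rewrite sqrrN expr1n. Qed.

(** A square at distance of order 2^-n from (0, 1), inside the disc and with side
    2^-n, on which the density of the bump is of order 4^n. *)
Definition bump_box n : set (R * R) := box (1 - 3 / 2 * hpow n) (hpow n / 2).

Lemma bump_box_disc n z : (0 < n)%N -> bump_box n z ->
  [/\ disc z, z.1 ^+ 2 <= hpow n ^+ 2 / 4, 0 <= z.2 & hpow n <= 1 - z.2 <= 2 * hpow n].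
Proof.
move=> n0 /boxE[]; have h0 := @hpow_gt0 R n.
have h1 : hpow n <= 2^-1 :> R.
  by case: n n0 {h0} => // n _; rewrite /hpow exprS ger_pMr// hpow_le1.
rewrite !ler_norml => /andP[a b] /andP[c d].
have y2 : 0 <= z.2 by lra.
have y3 : z.2 <= 1 - hpow n by lra.
have x2 : z.1 ^+ 2 <= hpow n ^+ 2 / 4 by nra.
split => //; last by apply/andP; split; lra.
rewrite /disc /=.
have : z.2 ^+ 2 <= (1 - hpow n) ^+ 2 by rewrite ler_pXn2r// nnegrE; lra.
nra.
Qed.

Lemma leb2_bump_box n : leb2 (bump_box n) = (hpow n ^+ 2)%:E.
Proof.
rewrite leb2_box; last by rewrite divr_ge0// ltW// hpow_gt0.
by congr (_%:E); field.
Qed.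

Lemma ln_le_subr1 (x : R) : 0 < x -> ln x <= x - 1.
Proof. by move=> x0; rewrite -[x in ln x](subrKC 1); apply: le_ln1Dx; lra. Qed.

Lemma ln_7hpow_le n : ln (7 * hpow n ^+ 2) <= 6 - n%:R :> R.
Proof.
have h0 := @hpow_gt0 R n.
rewrite lnM ?posrE ?exprn_gt0// lnXn// /hpow lnXn//.
have H7 : ln 7 <= 7 - 1 :> R by exact: ln_le_subr1.
have H2 : ln 2^-1 <= 2^-1 - 1 :> R by exact: ln_le_subr1.
have n0 : 0 <= n%:R :> R by [].
rewrite -[_ *+ n *+ 2]mulr_natr -[_ *+ n]mulr_natr.
nra.
Qed.

(** On the square the density is at least 1 / (108 * 4^-n) and the dipole at least
    n - 6. In the rest of the upper half-disc both factors are nonnegative. In the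
    lower half-disc the density is at most 4 * 8^-n, which absorbs the crude bound
    -6 * 4^n on the dipole. *)
Lemma density_dipole_ge n z : (5 < n)%N -> disc z ->
  - 24 + (n%:R - 6) / (108 * hpow n ^+ 2) * \1_(bump_box n) z <=
  bump_density (hpow n) z * dipole (hpow n) z.
Proof.
move=> n5 Dz; have h0 := @hpow_gt0 R n; have h1 := @hpow_le1 R n.
have zD : z.1 ^+ 2 + z.2 ^+ 2 < 1 := Dz.
have x2 := sqr_ge0 z.1; have y2 := sqr_ge0 z.2.
have y1 : -1 <= z.2 <= 1.
  by rewrite -ler_norml; apply: norm_le1; lra.
have /andP[yl yu] := y1.
have p1 := pole_gt0 h0 z s1; have p2 := pole_gt0 h0 z sN1.
have d0 : 0 <= bump_density (hpow n) z by exact: bump_density_ge0.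
have c0 := bump_denom_gt0 h0 z.
have h2 : 0 < hpow n ^+ 2 :> R by rewrite exprn_gt0.
rewrite indicE; case: (pselect (bump_box n z)) => [Bz|nBz].
  rewrite mem_set// mulr1.
  have [_ x3 y3 /andP[y4 y5]] := bump_box_disc (leq_trans (isT : (0 < 6)%N) n5) Bz.
  have n6 : 6 <= n%:R :> R by rewrite ler_nat.
  apply: (@le_trans _ _ ((108 * hpow n ^+ 2)^-1 * (n%:R - 6))).
    by rewrite [leRHS]mulrC; lra.
  have k0 : 0 <= (108 * hpow n ^+ 2)^-1 :> R by rewrite invr_ge0 mulr_ge0// ltW.
  apply: (ler_pM k0).
  - by rewrite subr_ge0.
  - rewrite /bump_density ler_pdivlMr ?exprn_gt0//.
    have M6 : bump_denom (hpow n) z <= 6 * hpow n ^+ 2.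
      by rewrite /bump_denom; nra.
    have M3 : bump_denom (hpow n) z ^+ 3 <= (6 * hpow n ^+ 2) ^+ 3.
      by rewrite lerXn2r ?nnegrE// ?ltW// mulr_gt0.
    apply: (@le_trans _ _ ((108 * hpow n ^+ 2)^-1 * (6 * hpow n ^+ 2) ^+ 3)).
      by rewrite ler_wpM2l// invr_ge0 mulr_ge0// ltW.
    rewrite [leLHS](_ : _ = 2 * hpow n ^+ 3 * hpow n); last by field; rewrite gt_eqF.
    by rewrite ler_wpM2l// mulr_ge0// exprn_ge0// ltW.
  - have P1 : 0 <= ln (pole (hpow n) 1 z).
      by apply: ln_ge0; rewrite /pole; nra.
    have P2 : ln (pole (hpow n) (-1) z) <= 6 - n%:R.
      apply: le_trans (ln_7hpow_le n); rewrite ler_ln ?posrE ?mulr_gt0//.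
      by rewrite /pole; nra.
    by rewrite /dipole; lra.
rewrite memNset// mulr0 addr0.
have [y0|y0] := leP 0 z.2.
  apply: (@le_trans _ _ 0); first lra.
  apply: mulr_ge0 => //; rewrite /dipole subr_ge0 ler_ln ?posrE//.
  by rewrite /pole; lra.
have dle : bump_density (hpow n) z <= 4 * hpow n ^+ 3.
  have M1 : 1 <= bump_denom (hpow n) z ^+ 3.
    by apply: exprn_ege1; rewrite /bump_denom; nra.
  rewrite /bump_density ler_pdivrMr ?exprn_gt0//.
  have h3 : 0 < hpow n ^+ 3 :> R by rewrite exprn_gt0.
  nra.
have dipole_ge : - (6 / hpow n ^+ 2) <= dipole (hpow n) z.
  rewrite /dipole -[leRHS]opprB lerN2 -ln_div ?posrE//.
  have q0 : 0 < pole (hpow n) (-1) z / pole (hpow n) 1 z by rewrite divr_gt0.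
  apply: le_trans (ltW (ln_sublinear q0)) _.
  rewrite ler_pM ?invr_ge0 ?(ltW p1) ?(ltW p2)//.
    have h4 : (1 + hpow n ^+ 2) * (z.1 ^+ 2 + z.2 ^+ 2 + 1) <= 2 * 2 :> R.
      by apply: ler_pM; nra.
    by rewrite /pole; lra.
  by rewrite lef_pV2 ?posrE//; exact: pole_ge_hpow.
have k0 : 0 <= 6 / hpow n ^+ 2 :> R by rewrite divr_ge0// ltW.
apply: (@le_trans _ _ (- (4 * hpow n ^+ 3 * (6 / hpow n ^+ 2)))).
  rewrite [X in _ <= - X](_ : _ = 24 * hpow n); last by field; rewrite gt_eqF.
  lra.
apply: (@le_trans _ _ (bump_density (hpow n) z * - (6 / hpow n ^+ 2))); last first.
  exact: ler_wpM2l.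
by rewrite mulrN lerN2; apply: ler_wpM2r.
Qed.

Lemma integral_density_dipole_ge n : (5 < n)%N ->
  (n%:R - 6) / 108 - 384 <=
  \int[leb2]_(z in disc) (@bump_density R (hpow n) z * @dipole R (hpow n) z).
Proof.
move=> n5; have h0 := @hpow_gt0 R n.
have mB : measurable (bump_box n : set R2) by exact: measurable_box.
have mind : measurable_fun (disc : set R2) (\1_(bump_box n) : R2 -> R).
  exact: measurable_indic.
have iB : L1_disc (\1_(bump_box n) : R2 -> R).
  apply: (@bounded_integrable_disc _ _ 1) => // z _.
  by rewrite indicE; case: (_ \in _); rewrite ?normr1 ?normr0.
have icst c : L1_disc (fun=> c : R).
  by apply: smooth_integrable_disc; exact: smooth_cst.
pose c : R := (n%:R - 6) / (108 * hpow n ^+ 2).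
have ciB : L1_disc (fun z => c * \1_(bump_box n) z).
  apply: (@bounded_integrable_disc _ _ `|c|); first exact: measurable_funM.
  move=> z _; rewrite normrM indicE ler_piMr//.
  by case: (_ \in _); rewrite ?normr1 ?normr0.
have isum : L1_disc (fun z => - 24 + c * \1_(bump_box n) z).
  exact: (integrableD measurable_disc (icst (-24)) ciB).
have idens : L1_disc (fun z => bump_density (hpow n) z * dipole (hpow n) z).
  apply: smooth_integrable_disc.
  by apply: smooth_mul; [exact: smooth_bump_density|exact: smooth_dipole].
apply: le_trans; last first.
  by apply: (le_Rintegral measurable_disc isum idens) => z Dz; exact: density_dipole_ge.
rewrite (RintegralD measurable_disc (icst (-24)) ciB) (RintegralZl _ measurable_disc iB).
rewrite (Rintegral_cst _ measurable_disc).
have -> : \int[leb2]_(z in disc) \1_(bump_box n) z = hpow n ^+ 2.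
  rewrite /Rintegral (integral_indic _ measurable_disc mB).
  rewrite (_ : _ `&` _ = bump_box n).
    by transitivity (fine (leb2 (bump_box n))) => //; rewrite leb2_bump_box.
  apply/setIidPl => z Bz.
  by have [] := bump_box_disc (leq_trans (isT : (0 < 6)%N) n5) Bz.
have -> : c * hpow n ^+ 2 = (n%:R - 6) / 108 by rewrite /c; field; rewrite gt_eqF.
rewrite addrC; apply: lerD => //.
have : fine (leb2 (disc : set (R * R))) <= 16.
  rewrite -lee_fin fineK; first exact: leb2_disc_le.
  by rewrite ge0_fin_numE// (le_lt_trans leb2_disc_le)// ltry.
move=> H; suff : - 384 <= - 24 * fine (leb2 (disc : set (R * R))) by [].
by lra.
Qed.

End LowerBound.

(** * Mean on the circle, Laplacian and energy of the dipole *)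
Section CircleAndNorms.
Context {R : realType}.
Local Notation R2 := (measurableTypeR R * measurableTypeR R)%type.
Implicit Types (z : R * R) (n : nat).

Let s1 : (1 : R) ^+ 2 = 1. Proof. by rewrite expr1n. Qed.
Let sN1 : (-1 : R) ^+ 2 = 1. Proof. by rewrite sqrrN expr1n. Qed.

(** Change of variables t -> a - t. *)
Lemma Rintegral_reflect (G : R -> R) (a : R) : 0 <= a -> continuous G ->
  \int[lebesgue_measure]_(t in `[0, a]) G t =
  \int[lebesgue_measure]_(t in `[0, a]) G (a - t).
Proof.
move=> a0 cG; rewrite /Rintegral; congr fine.
pose F : R -> R := fun t => a - t.
have dF (x : R) : is_derive x 1 F (-1).
  apply: (is_derive_eq (is_deriveB (is_derive_cst a x 1) (is_derive_id x 1))).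
  by rewrite sub0r.
have F'E : F^`()%classic = cst (-1).
  by apply/funext => x; rewrite derive1E (@derive_val _ _ _ _ _ _ _ (dF x)).
have cF : continuous F by move=> x; apply: cvgB => //; exact: cvg_cst.
have := @integration_by_substitution_decreasing R F G 0 a a0.
rewrite F'E /F subr0 subrr => -> //.
- by apply: eq_integral => x _; rewrite /= !fctE /= opprK mulr1.
- by move=> x y _ _ xy; rewrite ltrD2l ltrN2.
- by move=> x _; exact: cvg_cst.
- exact: is_cvg_cst.
- exact: is_cvg_cst.
- split.
  + by move=> x _; case: (dF x).
  + by apply: cvg_at_right_filter; exact: (cF 0).
  + by apply: cvg_at_left_filter; exact: (cF a).
- exact: continuous_subspaceT.
Qed.

(** The map t -> 2 pi - t preserves the cosine and reverses the sine. *)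
Lemma circle_integral_odd (f : R * R -> R) : smooth f ->
  (forall x y, f (x, - y) = - f (x, y)) -> circle_integral f = 0.
Proof.
move=> sf fodd; rewrite /circle_integral.
have pi2 : 0 <= 2 * pi :> R by rewrite mulr_ge0// pi_ge0.
have cG : continuous (fun t : R => f (cos t, sin t)).
  move=> t; apply: (@continuous2_cvg _ _ _ _ _ _ cos sin (fun x y => f (x, y))).
  - rewrite (_ : (fun p : R * R => f (p.1, p.2)) = f); first exact: (smooth_continuous sf).
    by apply/funext => -[].
  - exact: continuous_cos.
  - exact: continuous_sin.
have iG : lebesgue_measure.-integrable `[0, 2 * pi]
    (EFin \o (fun t : R => f (cos t, sin t))).
  apply: continuous_compact_integrable; first exact: segment_compact.
  exact: continuous_subspaceT.
have H := Rintegral_reflect pi2 cG.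
have E : \int[lebesgue_measure]_(t in `[0, 2 * pi]) f (cos (2 * pi - t), sin (2 * pi - t)) =
    - \int[lebesgue_measure]_(t in `[0, 2 * pi]) f (cos t, sin t).
  rewrite -mulN1r -RintegralZl//; apply: eq_Rintegral => t _.
  rewrite addrC [2 * pi]mulr_natl cosD2pi sinD2pi cosN sinN fodd.
  by rewrite mulN1r.
by rewrite E in H; lra.
Qed.

Lemma circle_integral_dipole n : circle_integral (dipole (@hpow R n)) = 0.
Proof.
apply: circle_integral_odd; last exact: dipole_odd.
by apply: smooth_dipole; exact: hpow_gt0.
Qed.

Definition dipole_lap n z : R := \sum_j dipole_der2 (hpow n) (basis2 j) z.

Lemma integral_lap_dipole n :
  (\int[leb2]_(z in disc) `|dipole_lap n z|%:E <= 768%:E)%E.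
Proof.
have h0 := @hpow_gt0 R n; have h1 := @hpow_le1 R n.
pose g s z := hpow n ^+ 2 * (pole (hpow n) s z)^-1 ^+ 2.
have mg s : s ^+ 2 = 1 -> measurable_fun (disc : set R2) (g s).
  move=> ss; apply: smooth_measurable; apply: smooth_scale; apply: smooth_sqr.
  exact: smooth_pole_inv.
have g0 s z : 0 <= g s z by rewrite mulr_ge0 ?sqr_ge0.
apply: (@le_trans _ _ (\int[leb2]_(z in disc) (12%:E * ((g 1 z)%:E + (g (-1) z)%:E)))%E).
  apply: ge0_le_integral_nonmeas => z Dz; rewrite ?lee_fin//.
  rewrite /dipole_lap lap_dipole// normrM.
  have -> : 12 * (g 1 z + g (-1) z) =
      12 * hpow n ^+ 2 * ((pole (hpow n) 1 z)^-1 ^+ 2 + (pole (hpow n) (-1) z)^-1 ^+ 2).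
    by rewrite /g; ring.
  apply: ler_pM => //.
    have q0 := sqr_ge0 (@hpow R n).
    have q1 : hpow n ^+ 2 <= 1 :> R by rewrite exprn_ile1// ltW.
    by rewrite ger0_norm; nra.
  rewrite -!exprVn (le_trans (ler_normB _ _))//.
  by rewrite !ger0_norm ?sqr_ge0.
rewrite ge0_integralZl_EFin//; last 3 first.
- exact: measurable_disc.
- by move=> z _; rewrite -EFinD lee_fin addr_ge0.
- by apply: emeasurable_funD; apply/measurable_EFinP; exact: mg.
rewrite ge0_integralD//; last 5 first.
- exact: measurable_disc.
- by move=> z _; rewrite lee_fin.
- by apply/measurable_EFinP; exact: mg.
- by move=> z _; rewrite lee_fin.
- by apply/measurable_EFinP; exact: mg.
apply: (@le_trans _ _ (12%:E * (32%:E + 32%:E))%E).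
  by apply: lee_wpmul2l; rewrite ?lee_fin//; apply: leeD; exact: integral_pole_inv2.
by rewrite -EFinD -EFinM lee_fin; lra.
Qed.

Lemma integral_grad_dipole n :
  (\int[leb2]_(z in disc) (\sum_j grad (dipole (hpow n)) z 0 j ^+ 2)%:E <=
   (512 * n.+1%:R : R)%:E)%E.
Proof.
have h0 := @hpow_gt0 R n; have h1 := @hpow_le1 R n.
pose g s z := (pole (hpow n) s z)^-1.
have mg s : s ^+ 2 = 1 -> measurable_fun (disc : set R2) (g s).
  by move=> ss; apply: smooth_measurable; exact: smooth_pole_inv.
have g0 s z : s ^+ 2 = 1 -> 0 <= g s z.
  by move=> ss; rewrite invr_ge0 ltW// pole_gt0.
apply: (@le_trans _ _ (\int[leb2]_(z in disc) (16%:E * ((g 1 z)%:E + (g (-1) z)%:E)))%E).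
  apply: ge0_le_integral_nonmeas => z Dz; rewrite lee_fin.
    by apply: sumr_ge0 => j _; exact: sqr_ge0.
  apply: le_trans (sqr_grad_dipole h0 z) _; rewrite ler_wpM2r//.
    by apply: addr_ge0; exact: g0.
  nra.
rewrite ge0_integralZl_EFin//; last 3 first.
- exact: measurable_disc.
- by move=> z _; rewrite -EFinD lee_fin addr_ge0// g0.
- by apply: emeasurable_funD; apply/measurable_EFinP; exact: mg.
rewrite ge0_integralD//; last 5 first.
- exact: measurable_disc.
- by move=> z _; rewrite lee_fin g0.
- by apply/measurable_EFinP; exact: mg.
- by move=> z _; rewrite lee_fin g0.
- by apply/measurable_EFinP; exact: mg.
apply: (@le_trans _ _ (16%:E * ((16 * n.+1%:R)%:E + (16 * n.+1%:R)%:E))%E).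
  by apply: lee_wpmul2l; rewrite ?lee_fin//; apply: leeD; exact: integral_pole_inv.
by rewrite -EFinD -EFinM lee_fin; lra.
Qed.

End CircleAndNorms.

(** * Cutoffs by compactly supported smooth functions *)
Section Cutoff.
Context {R : realType}.
Local Notation R2 := (measurableTypeR R * measurableTypeR R)%type.
Implicit Types (z : R * R) (t : R) (k n : nat).

Lemma flat0_le1 t : flat 0 t <= 1.
Proof.
rewrite /flat; case: ifP => // t0; rewrite expr0 invr1 mul1r expR_le1 oppr_le0 invr_ge0.
exact: ltW.
Qed.

Lemma flat0_ge t : 0 < t -> 1 - 2 / t <= flat 0 (t - 1).
Proof.
move=> t0; have [t2|t2] := ltP t 2.
  apply: le_trans (flat_ge0 _ _); rewrite subr_le0 ler_pdivlMr//; lra.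
have u0 : 0 < t - 1 by lra.
rewrite /flat u0 expr0 invr1 mul1r.
apply: le_trans (expR_ge1Dx _); rewrite lerD2l lerN2.
by rewrite -[leLHS]mul1r ler_pdivrMr// mulrAC ler_pdivlMr//; lra.
Qed.

Lemma flat2_le2 t : flat 2 t <= 2.
Proof.
rewrite /flat; case: ifP => // t0.
have ti : 0 <= t^-1 by rewrite invr_ge0 ltW.
have := expR_ge1Dxn 1 ti; rewrite -exprVn expRN.
have e0 := expR_gt0 t^-1.
by rewrite ler_pdivrMr// (_ : 2`! = 2)// => ?; lra.
Qed.

Lemma flat2_shift_ge0 t : 0 < t -> 0 <= t * flat 2 (t - 1).
Proof. by move=> t0; rewrite mulr_ge0 ?flat_ge0// ltW. Qed.

(** With [flat2_shift_le4], the term t * flat 2 (t - 1) is bounded and tends to 0 at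
    infinity. This is what dominated convergence needs for [layer]. *)
Lemma flat2_shift_le t : 0 < t -> t * flat 2 (t - 1) <= 8 / t.
Proof.
move=> t0; rewrite ler_pdivlMr//; have [t2|t2] := ltP t 2.
  have := flat2_le2 (t - 1); have := flat_ge0 2 (t - 1); nra.
have u0 : 0 < t - 1 by lra.
rewrite /flat u0.
have e1 : expR (- (t - 1)^-1) <= 1 by rewrite expR_le1 oppr_le0 invr_ge0 ltW.
have e0 := expR_ge0 (- (t - 1)^-1).
rewrite mulrCA -mulrA mulrC ler_pdivrMr ?exprn_gt0//.
nra.
Qed.

Lemma flat2_shift_le4 t : 0 < t -> t * flat 2 (t - 1) <= 4.
Proof.
move=> t0; have [t2|t2] := ltP t 2.
  have := flat2_le2 (t - 1); have := flat_ge0 2 (t - 1); nra.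
by apply: le_trans (flat2_shift_le t0) _; rewrite ler_pdivrMr//; lra.
Qed.

(** The distance to the circle in units of 1 / (k + 1), up to a bounded factor. *)
Definition depth k z : R := k.+1%:R * (1 - (z.1 ^+ 2 + z.2 ^+ 2)).

Lemma depth_gt0 k z : disc z -> 0 < depth k z.
Proof. by move=> Dz; rewrite mulr_gt0// subr_gt0. Qed.

Lemma smooth_depth k : smooth (depth k).
Proof. by apply: smooth_scale; exact: (smooth_sub (smooth_cst 1) smooth_radius). Qed.

Lemma is_derive_depth k z v :
  is_derive z v (depth k) (- (k.+1%:R * (2 * (z.1 * v.1 + z.2 * v.2)))).
Proof.
apply: (is_derive_eq (is_derive_scale k.+1%:R (is_derive_sub (is_derive_const 1 z v)
  (is_derive_add (is_derive_sqr (is_derive_fst z v))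
    (is_derive_sqr (is_derive_snd z v)))))).
by ring.
Qed.

(** The support lies in the region where the depth is at least 1, compact in the
    disc. As k tends to infinity the cutoff tends to 1, because [flat 0] does so at
    infinity. *)
Definition cutoff k z : R := flat 0 (depth k z - 1).

Lemma smooth_cutoff k : smooth (cutoff k).
Proof. by apply: smooth_flat; apply: (smooth_sub (smooth_depth k)); exact: smooth_cst. Qed.

Lemma is_derive_cutoff k z v : is_derive z v (cutoff k)
  (- flat 2 (depth k z - 1) * (k.+1%:R * (2 * (z.1 * v.1 + z.2 * v.2)))).
Proof.
apply: (is_derive_eq (is_derive_chain (is_derive_flat 0 (depth k z - 1))
  (is_derive_sub (is_derive_depth k z v) (is_derive_const 1 z v)))).
by rewrite mul0r !subr0 mulrN mulNr.
Qed.

Lemma test_function_cutoff k (g : R * R -> R) : smooth g ->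
  test_function (fun z => cutoff k z * g z).
Proof.
move=> sg; split.
  by move=> m; apply: smooth_Ck_cdisc; exact: smooth_mul (smooth_cutoff k) sg.
have sub : [set z : R * R | 1 <= depth k z] `<=` disc.
  move=> z /=; rewrite /disc /= /depth => H; rewrite ltNge; apply/negP => r1.
  have : k.+1%:R * (1 - (z.1 ^+ 2 + z.2 ^+ 2)) <= 0 by rewrite mulr_ge0_le0// subr_le0.
  lra.
exists [set z | 1 <= depth k z]; split => //.
- apply: (@subclosed_compact _ _ cdisc); last first.
  + by move=> z /sub; exact: disc_subset_cdisc.
  + exact: cdisc_compact.
  + apply: (@preimage_closed _ _ (depth k) [set x | 1 <= x]); last exact: closed_ge.
    by move=> z _; exact: (smooth_continuous (smooth_depth k)).
- move=> z /negP; rewrite -ltNge => H.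
  by rewrite /cutoff /flat ifF ?mul0r//; apply/negbTE; rewrite -leNgt; lra.
Qed.

Lemma cvg_cutoff z : disc z -> cutoff k z @[k --> \oo] --> (1 : R).
Proof.
move=> Dz; pose c : R := 1 - (z.1 ^+ 2 + z.2 ^+ 2).
have c0 : 0 < c by rewrite subr_gt0.
have H : (fun k => 1 - 2 / c * harmonic k) @ \oo --> (1 : R).
  rewrite -[X in _ --> X]subr0; apply: cvgB; first exact: cvg_cst.
  rewrite -(mulr0 (2 / c)); apply: cvgM; [exact: cvg_cst|exact: cvg_harmonic].
apply: (squeeze_cvgr _ H (cvg_cst _)); near=> k.
rewrite flat0_le1 andbT; apply: le_trans (flat0_ge (depth_gt0 k Dz)).
rewrite lerD2l lerN2 /harmonic /= /depth -/c le_eqVlt; apply/orP; left; apply/eqP.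
by field; rewrite (gt_eqF c0) nat1r pnatr_eq0.
Unshelve. all: by end_near. Qed.

(** Up to the factor -2 w this is the product of the gradient of the cutoff with a
    field F such that z . F = (1 - |z|^2) w: the factor 1 - |z|^2 makes up for the
    slope of order k of the cutoff. *)
Definition layer k z : R := depth k z * flat 2 (depth k z - 1).

Lemma layer_ge0 k z : disc z -> 0 <= layer k z.
Proof. by move=> Dz; rewrite flat2_shift_ge0// depth_gt0. Qed.

Lemma layer_le4 k z : disc z -> layer k z <= 4.
Proof. by move=> Dz; rewrite flat2_shift_le4// depth_gt0. Qed.

Lemma cvg_layer z : disc z -> layer k z @[k --> \oo] --> (0 : R).
Proof.
move=> Dz; pose c : R := 1 - (z.1 ^+ 2 + z.2 ^+ 2).
have c0 : 0 < c by rewrite subr_gt0.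
have H : (fun k => 8 / c * harmonic k) @ \oo --> (0 : R).
  rewrite -(mulr0 (8 / c)); apply: cvgM; [exact: cvg_cst|exact: cvg_harmonic].
apply: (squeeze_cvgr _ (cvg_cst _) H); near=> k.
rewrite flat2_shift_ge0 ?depth_gt0//=; apply: le_trans (flat2_shift_le (depth_gt0 k Dz)) _.
rewrite /harmonic /= /depth -/c le_eqVlt; apply/orP; left; apply/eqP.
by field; rewrite (gt_eqF c0) nat1r pnatr_eq0.
Unshelve. all: by end_near. Qed.

Lemma smooth_layer k : smooth (layer k).
Proof.
apply: (smooth_mul (smooth_depth k)); apply: smooth_flat.
by apply: (smooth_sub (smooth_depth k)); exact: smooth_cst.
Qed.

End Cutoff.

(** * Flux of a weak gradient against a field tangent to the circle *)
Section WeakFlux.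
Context {R : realType}.
Local Notation R2 := (measurableTypeR R * measurableTypeR R)%type.
Implicit Types (z : R * R) (k n : nat).

Lemma sum_ord2 (f : 'I_2 -> R) : \sum_j f j = f 0 + f 1.
Proof.
rewrite !big_ord_recl big_ord0 addr0; congr (_ + f _).
exact: val_inj.
Qed.

Lemma integrable_add (f g : R * R -> R) : L1_disc f -> L1_disc g ->
  L1_disc (fun z => f z + g z).
Proof. by move=> if_ ig; exact: (integrableD measurable_disc if_ ig). Qed.

Lemma integrable_scale c (f : R * R -> R) : L1_disc f -> L1_disc (fun z => c * f z).
Proof. by move=> if_; exact: (integrableZl measurable_disc c if_). Qed.

Lemma integrable_norm (f : R * R -> R) : L1_disc f -> L1_disc (fun z => `|f z|).
Proof. by move=> if_; exact: (integrable_abse if_). Qed.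

Lemma integrable_dotv (G : R * R -> 'rV[R]_2) (F : 'I_2 -> R * R -> R) :
  (forall j, L1_disc (fun z => G z 0 j)) -> (forall j, smooth (F j)) ->
  L1_disc (fun z => dotv (G z) (\row_j F j z)).
Proof.
move=> iG sF.
rewrite [X in L1_disc X](_ : _ = fun z => G z 0 0 * F 0 z + G z 0 1 * F 1 z); last first.
  by apply/funext => z; rewrite /dotv sum_ord2 !mxE.
by apply: integrable_add; exact: integrable_mul_smooth.
Qed.

Lemma Rintegral_dominated_cvg (f_ : nat -> R * R -> R) (f g : R * R -> R) :
  (forall k, measurable_fun (disc : set R2) (f_ k)) ->
  measurable_fun (disc : set R2) f ->
  (forall z, disc z -> f_ k z @[k --> \oo] --> f z) ->
  L1_disc g -> (forall k z, disc z -> `|f_ k z| <= g z) ->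
  \int[leb2]_(z in disc) f_ k z @[k --> \oo] --> \int[leb2]_(z in disc) f z.
Proof.
move=> mf_ mf cf ig fg.
have [|||||if_ _ H] := @dominated_convergence _ _ _
   (@lebesgue_measure R \x @lebesgue_measure R)%E (disc : set R2)
   measurable_disc (fun k z => (f_ k z)%:E) (EFin \o f) (EFin \o g).
- by move=> k; apply/measurable_EFinP; exact: mf_.
- by apply/measurable_EFinP; exact: mf.
- by apply: aeW => z Dz; apply: cvg_EFin; [exact: nearW|exact: cf].
- exact: ig.
- by apply: aeW => z k Dz; rewrite lee_fin; exact: fg.
apply: fine_cvg; rewrite fineK; first exact: H.
exact: (integrable_fin_num measurable_disc if_).
Qed.

Section Flux.
Variables (u : R * R -> R) (G : R * R -> 'rV[R]_2) (N : R).
Variables (F dF : 'I_2 -> R * R -> R) (w : R * R -> R).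
Hypothesis uL1 : L1_disc u.
Hypothesis uG : is_weak_grad u G.
Hypothesis N0 : 0 <= N.
Hypothesis uN : {ae (@lebesgue_measure R \x @lebesgue_measure R)%E,
  forall z, disc z -> `|u z| <= N}.
Hypothesis sF : forall j, smooth (F j).
Hypothesis sdF : forall j, smooth (dF j).
Hypothesis sw : smooth w.
Hypothesis FdF : forall j z, is_derive z (basis2 j) (F j) (dF j z).
Hypothesis Fw : forall z, z.1 * F 0 z + z.2 * F 1 z = (1 - (z.1 ^+ 2 + z.2 ^+ 2)) * w z.

Let cutoff_div k z := cutoff k z * (\sum_j dF j z) - 2 * w z * layer k z.
Let flux z := dotv (G z) (\row_j F j z).
Let iG j : L1_disc (fun z => G z 0 j). Proof. by have [] := uG j. Qed.

Let sdiv : smooth (fun z => \sum_j dF j z).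
Proof. by under eq_fun do rewrite sum_ord2; exact: smooth_add. Qed.

(** The divergence of cutoff k times F. *)
Lemma divergence_cutoff k z :
  \sum_j grad (fun z => cutoff k z * F j z) z 0 j = cutoff_div k z.
Proof.
rewrite /cutoff_div !sum_ord2 !mxE.
rewrite !(@derive_val _ _ _ _ _ _ _ (is_derive_mul (is_derive_cutoff k z _) (FdF _ z))).
rewrite /basis2 /=.
have -> : 2 * w z * layer k z =
    2 * k.+1%:R * flat 2 (depth k z - 1) * (z.1 * F 0 z + z.2 * F 1 z).
  by rewrite Fw /layer {1}/depth; ring.
ring.
Qed.

Lemma smooth_cutoff_div k : smooth (cutoff_div k).
Proof.
apply: smooth_sub; first exact: smooth_mul (smooth_cutoff k) sdiv.
apply: smooth_mul; last exact: smooth_layer.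
exact: smooth_scale.
Qed.

(** The definition of the weak gradient, with cutoff k times F j as test
    functions. *)
Lemma cutoff_flux k :
  \int[leb2]_(z in disc) (cutoff k z * flux z) =
  - \int[leb2]_(z in disc) (u z * cutoff_div k z).
Proof.
have sg j : smooth (fun z => grad (fun z => cutoff k z * F j z) z 0 j).
  rewrite [X in smooth X](_ : _ = fun z =>
    (- flat 2 (depth k z - 1) * (k.+1%:R * (2 * (z.1 * (basis2 j).1 + z.2 * (basis2 j).2))))
      * F j z + cutoff k z * dF j z).
    apply: smooth_add; last exact: smooth_mul (smooth_cutoff k) (sdF j).
    apply: smooth_mul => //; apply: smooth_mul.
      apply: smooth_opp; apply: smooth_flat.
      by apply: (smooth_sub (smooth_depth k)); exact: smooth_cst.
    do 2 apply: smooth_scale; apply: smooth_add.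
      exact: smooth_mul smooth_fst (smooth_cst _).
    exact: smooth_mul smooth_snd (smooth_cst _).
  apply/funext => z; rewrite mxE.
  by rewrite (@derive_val _ _ _ _ _ _ _ (is_derive_mul (is_derive_cutoff k z _) (FdF _ z))).
have sc j : smooth (fun z => cutoff k z * F j z).
  exact: smooth_mul (smooth_cutoff k) (sF j).
have W j : \int[leb2]_(z in disc) (u z * grad (fun z => cutoff k z * F j z) z 0 j) =
  - \int[leb2]_(z in disc) (G z 0 j * (cutoff k z * F j z)).
  by have [_] := uG j; apply; exact: test_function_cutoff.
have -> : \int[leb2]_(z in disc) (u z * cutoff_div k z) =
    \int[leb2]_(z in disc) (u z * grad (fun z => cutoff k z * F 0 z) z 0 0) +
    \int[leb2]_(z in disc) (u z * grad (fun z => cutoff k z * F 1 z) z 0 1).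
  rewrite -(RintegralD measurable_disc); last 2 first.
  - exact: integrable_mul_smooth.
  - exact: integrable_mul_smooth.
  by apply: eq_Rintegral => z _; rewrite -divergence_cutoff sum_ord2 mulrDr.
rewrite !W -opprD opprK.
rewrite -(RintegralD measurable_disc); last 2 first.
- exact: integrable_mul_smooth.
- exact: integrable_mul_smooth.
apply: eq_Rintegral => z _; rewrite /flux /dotv sum_ord2 !mxE; ring.
Qed.

Let mflux : measurable_fun (disc : set R2) flux.
Proof. by have /measurable_int/measurable_EFinP := integrable_dotv iG sF. Qed.

Let mu_ : measurable_fun (disc : set R2) u.
Proof. by have /measurable_int/measurable_EFinP := uL1. Qed.

Lemma cvg_cutoff_flux :
  \int[leb2]_(z in disc) (cutoff k z * flux z) @[k --> \oo] -->
  \int[leb2]_(z in disc) flux z.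
Proof.
apply: (@Rintegral_dominated_cvg _ _ (fun z => `|flux z|)) => //.
- by move=> k; apply: measurable_funM => //; apply: smooth_measurable; exact: smooth_cutoff.
- move=> z Dz; rewrite -[X in _ --> X]mul1r; apply: cvgM; last exact: cvg_cst.
  exact: cvg_cutoff.
- exact: integrable_norm (integrable_dotv iG sF).
- move=> k z Dz; rewrite normrM ler_piMl// ger0_norm ?flat_ge0//.
  exact: flat0_le1.
Qed.

Lemma cvg_layer_integral :
  \int[leb2]_(z in disc) (2 * `|w z| * layer k z) @[k --> \oo] --> (0 : R).
Proof.
have [C wC] := smooth_bounded sw.
have -> : (0 : R) = \int[leb2]_(z in disc) (fun=> 0) z by rewrite /Rintegral integral0.
apply: (@Rintegral_dominated_cvg _ _ (fun z => 2 * C * 4)) => //.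
- move=> k; apply: measurable_funM; last by apply: smooth_measurable; exact: smooth_layer.
  apply: measurable_funM => //; apply: measurableT_comp => //.
  exact: smooth_measurable.
- move=> z Dz; rewrite -(mulr0 (2 * `|w z|)); apply: cvgM; first exact: cvg_cst.
  exact: cvg_layer.
- by apply: smooth_integrable_disc; exact: smooth_cst.
- move=> k z Dz; rewrite ger0_norm; last by rewrite mulr_ge0 ?layer_ge0 ?mulr_ge0.
  apply: ler_pM => //.
  + exact: layer_ge0.
  + by rewrite ler_pM2l// wC.
  + exact: layer_le4.
Qed.

Lemma cutoff_flux_le k :
  `|\int[leb2]_(z in disc) (cutoff k z * flux z)| <=
  N * (\int[leb2]_(z in disc) `|\sum_j dF j z| +
       \int[leb2]_(z in disc) (2 * `|w z| * layer k z)).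
Proof.
have iud : L1_disc (fun z => u z * cutoff_div k z).
  by apply: integrable_mul_smooth => //; exact: smooth_cutoff_div.
have i1 : L1_disc (fun z => `|\sum_j dF j z|).
  exact: integrable_norm (smooth_integrable_disc sdiv).
have i2 : L1_disc (fun z => 2 * `|w z| * layer k z).
  apply: integrable_mul_smooth; last exact: smooth_layer.
  exact: (integrable_scale 2 (integrable_norm (smooth_integrable_disc sw))).
rewrite cutoff_flux normrN -(RintegralD measurable_disc i1 i2).
rewrite -(RintegralZl _ measurable_disc (integrable_add i1 i2)).
apply: le_trans (le_normr_Rintegral measurable_disc iud) _.
have i3 : L1_disc (fun z => N * (`|\sum_j dF j z| + 2 * `|w z| * layer k z)).
  exact: (integrable_scale N (integrable_add i1 i2)).
have g0 z : disc z -> 0 <= N * (`|\sum_j dF j z| + 2 * `|w z| * layer k z).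
  move=> Dz; apply: mulr_ge0 => //; apply: addr_ge0 => //.
  by apply: mulr_ge0; [exact: mulr_ge0|exact: layer_ge0].
apply: fine_le.
- exact: (integrable_fin_num measurable_disc (integrable_norm iud)).
- exact: (integrable_fin_num measurable_disc i3).
apply: (ae_ge0_le_integral measurable_disc).
- by move=> z Dz; rewrite lee_fin.
- exact: (measurable_int _ (integrable_norm iud)).
- by move=> z Dz; rewrite lee_fin; exact: g0.
- exact: (measurable_int _ i3).
case: uN => A [mA A0 sub]; exists A; split => // z nz; apply: sub => uNz; apply: nz => Dz.
rewrite lee_fin normrM ler_pM ?uNz//.
rewrite /cutoff_div; apply: le_trans (ler_normB _ _) _; apply: lerD.
  by rewrite normrM ler_piMl// ger0_norm ?flat_ge0// flat0_le1.
by rewrite normrM (ger0_norm (layer_ge0 k Dz)) normrM (ger0_norm (ler0n _ 2)).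
Qed.

(** For a field F tangent to the unit circle, integration by parts against F has
    no boundary term, even though u has only a trace in L^1: cut off, and let the
    cutoff tend to 1. The boundary layer disappears in the limit. *)
Lemma weak_flux_le :
  `|\int[leb2]_(z in disc) flux z| <= N * \int[leb2]_(z in disc) `|\sum_j dF j z|.
Proof.
apply: ler_cvg_to (cvg_norm cvg_cutoff_flux) _ _; last first.
  by apply: nearW => k; exact: cutoff_flux_le.
rewrite -[X in N * X]addr0; apply: cvgM; first exact: cvg_cst.
by apply: cvgD; [exact: cvg_cst|exact: cvg_layer_integral].
Qed.

End Flux.
End WeakFlux.

(** * Blow-up of the solutions *)
Section BlowUp.
Context {R : realType}.
Local Notation R2 := (measurableTypeR R * measurableTypeR R)%type.
Implicit Types (z : R * R) (n : nat) (u : R * R -> R).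

Definition source n z : R := \det (jacobian2 (bump (hpow n)) z).

Lemma weak_gradP u : W11_disc u -> is_weak_grad u (weak_grad u).
Proof. by move=> [_ ex]; exact: (xgetPex _ ex). Qed.

(** The term with the integral of the source disappears since the dipole has mean
    0 on the circle. *)
Lemma neumann_flux n u : neumann_solution (source n) u ->
  \int[leb2]_(z in disc) dotv (weak_grad u z) (\row_j dipole_der (hpow n) (basis2 j) z) =
  \int[leb2]_(z in disc) (@bump_density R (hpow n) z * @dipole R (hpow n) z).
Proof.
move=> [uW H]; have h0 := @hpow_gt0 R n.
have iG j : L1_disc (fun z => weak_grad u z 0 j) by have [] := weak_gradP uW j.
have i1 := integrable_dotv iG (fun j => smooth_dipole_der h0 (basis2 j)).
have i2 : L1_disc (fun z => bump_density (hpow n) z * dipole (hpow n) z).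
  apply: smooth_integrable_disc.
  by apply: smooth_mul; [exact: smooth_bump_density|exact: smooth_dipole].
have := H (dipole (hpow n)) (smooth_Ck_cdisc 1 (smooth_dipole h0)).
rewrite circle_integral_dipole mulr0.
have -> : \int[leb2]_(z in disc) (dotv (weak_grad u z) (grad (dipole (hpow n)) z) -
    source n z * dipole (hpow n) z) =
  \int[leb2]_(z in disc) (dotv (weak_grad u z) (\row_j dipole_der (hpow n) (basis2 j) z) -
     @bump_density R (hpow n) z * @dipole R (hpow n) z).
  apply: eq_Rintegral => z _; rewrite /source det_jacobian_bump//; congr (dotv _ _ - _).
  by apply/rowP => j; rewrite grad_dipole// mxE.
rewrite (RintegralB measurable_disc i1 i2) => /eqP.
by rewrite eq_sym subr_eq0 => /eqP.
Qed.

Lemma leb2_setT_gt0 : (0 < leb2 (setT : set (R * R)))%E.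
Proof.
apply: (@lt_le_trans _ _ (leb2 (box (0 : R) 1))).
  by rewrite leb2_box// lte_fin; lra.
by apply: le_measure; rewrite ?inE//; exact: measurable_box.
Qed.

Lemma Lp_disc_infty_le u (N : R) : (Lp_disc +oo u <= N%:E)%E ->
  {ae (@lebesgue_measure R \x @lebesgue_measure R)%E, forall z, disc z -> `|u z| <= N}.
Proof.
rewrite /Lp_disc unlock /=; rewrite (_ : (0 < _)%E = true); last exact: leb2_setT_gt0.
move=> /ess_supP [A [mA A0 sub]]; exists A; split => // z nz.
apply: sub => uNz; apply: nz => Dz.
by move: uNz; rewrite /= patchE mem_set.
Qed.

(** The dipole has a Laplacian bounded in L^1, so that the supremum of |u|
    controls the pairing, which grows like n. *)
Lemma source_sup_bound n u (N : R) : (5 < n)%N -> 0 <= N ->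
  neumann_solution (source n) u -> (Lp_disc +oo u <= N%:E)%E ->
  (n%:R - 6) / 108 - 384 <= N * 768.
Proof.
move=> n5 N0 un uN; have h0 := @hpow_gt0 R n; have [uW _] := un.
apply: le_trans (integral_density_dipole_ge n5) _; rewrite -(neumann_flux un).
(* The cofactor of 1 - |z|^2 in the radial derivative of the dipole. *)
pose w z : R := (1 + hpow n ^+ 2) * ((pole (hpow n) (-1) z)^-1 - (pole (hpow n) 1 z)^-1).
have := @weak_flux_le R u (weak_grad u) N (fun j => dipole_der (hpow n) (basis2 j))
  (fun j => dipole_der2 (hpow n) (basis2 j)) w.
move=> /(_ uW.1 (weak_gradP uW) N0 (Lp_disc_infty_le uN)) W.
apply: le_trans (ler_norm _) _; apply: le_trans (W _ _ _ _ _) _.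
- by move=> j; exact: smooth_dipole_der.
- by move=> j; exact: smooth_dipole_der2.
- by apply: smooth_scale; apply: smooth_sub; apply: smooth_pole_inv;
    rewrite ?sqrrN expr1n.
- by move=> j z; exact: is_derive_dipole_der.
- by move=> z; rewrite radial_dipole// /w opprD addrA mulrA.
rewrite ler_wpM2l// -lee_fin fineK; first exact: integral_lap_dipole.
rewrite ge0_fin_numE; last by apply: integral_ge0 => z _; rewrite lee_fin.
by apply: le_lt_trans (integral_lap_dipole n) _; rewrite ltry.
Qed.

(** Here a . b <= c a^2 + b^2 / (4 c) is used pointwise with c = 128 * 216, for
    which the energy 512 (n + 1) of the dipole contributes (n + 1) / 216 only: half
    of the growth n / 108 of the pairing. *)
Lemma source_energy_bound n u (A : R) : (5 < n)%N ->
  neumann_solution (source n) u ->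
  (\int[leb2]_(z in disc) (enorm (weak_grad u z) ^+ 2)%:E <= A%:E)%E ->
  (n%:R - 6) / 108 - 384 <= (128 * 216) * A + (n%:R + 1) / 216.
Proof.
move=> n5 un uA; have h0 := @hpow_gt0 R n; have [uW _] := un.
apply: le_trans (integral_density_dipole_ge n5) _; rewrite -(neumann_flux un).
have iG j : L1_disc (fun z => weak_grad u z 0 j) by have [] := weak_gradP uW j.
have i1 := integrable_dotv iG (fun j => smooth_dipole_der h0 (basis2 j)).
have mE : measurable_fun (disc : set R2) (fun z => enorm (weak_grad u z)).
  apply: measurable_enorm => i j; rewrite (ord1 i).
  by have /measurable_int/measurable_EFinP := iG j.
have i2 : L1_disc (fun z => enorm (weak_grad u z) ^+ 2).
  apply/integrableP; split; first by apply/measurable_EFinP; exact: measurable_funX.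
  apply: le_lt_trans (ltry A); apply: le_trans uA.
  rewrite le_eqVlt; apply/orP; left; apply/eqP; apply: eq_integral => z _.
  by rewrite /= ger0_norm ?sqr_ge0.
have i3 : L1_disc (fun z => \sum_j grad (dipole (hpow n)) z 0 j ^+ 2).
  under eq_fun do under eq_bigr do rewrite grad_dipole//.
  apply: smooth_integrable_disc; under eq_fun do rewrite sum_ord2.
  by apply: smooth_add; apply: smooth_sqr; exact: smooth_dipole_der.
have i2' := integrable_scale (128 * 216) i2.
have i3' := integrable_scale ((4 * (128 * 216))^-1) i3.
have i4 := integrable_add i2' i3'.
apply: le_trans (le_Rintegral measurable_disc i1 i4 _) _.
  move=> z Dz; rewrite /enorm sqr_sqrtr; last first.
    by apply: sumr_ge0 => i _; apply: sumr_ge0 => j _; exact: sqr_ge0.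
  rewrite big_ord1 /dotv !sum_ord2 !grad_dipole// !mxE.
  have K (a b : R) : a * b <= (128 * 216) * a ^+ 2 + (4 * (128 * 216))^-1 * b ^+ 2.
    rewrite -subr_ge0 [leRHS](_ : _ =
      (128 * 216) * (a - b / (2 * (128 * 216))) ^+ 2); last by field.
    by rewrite mulr_ge0 ?sqr_ge0.
  have := K (weak_grad u z 0 0) (dipole_der (hpow n) (basis2 0) z).
  have := K (weak_grad u z 0 1) (dipole_der (hpow n) (basis2 1) z).
  lra.
rewrite (RintegralD measurable_disc i2' i3').
rewrite (RintegralZl _ measurable_disc i2) (RintegralZl _ measurable_disc i3).
apply: lerD.
  rewrite ler_wpM2l// -lee_fin fineK//; exact: (integrable_fin_num measurable_disc i2).
have : \int[leb2]_(z in disc) (\sum_j grad (dipole (hpow n)) z 0 j ^+ 2) <=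
    512 * n.+1%:R :> R.
  rewrite -lee_fin fineK; first exact: integral_grad_dipole.
  exact: (integrable_fin_num measurable_disc i3).
rewrite -[n.+1%:R]natr1 => H.
apply: (@le_trans _ _ ((4 * (128 * 216))^-1 * (512 * (n%:R + 1)))).
  by apply: ler_wpM2l; [rewrite invr_ge0|exact: H].
lra.
Qed.

Lemma Lp_disc2_le (g : R * R -> R) (A : R) : 0 <= A ->
  (Lp_disc 2%:E g <= A%:E)%E ->
  (\int[leb2]_(z in disc) (g z ^+ 2)%:E <= (A ^+ 2)%:E)%E.
Proof.
move=> A0; rewrite /Lp_disc; set f := EFin \o _ => fA.
have -> : (\int[leb2]_(z in disc) (g z ^+ 2)%:E =
   \int[leb2]_z (`|f z| `^ 2))%E.
  rewrite integral_mkcond; apply: eq_integral => z _.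
  rewrite /f /= !patchE; case: ifPn => _; last by rewrite normr0 ?poweR0r ?powR0.
  by rewrite powR_mulrn// real_normK ?num_real.
rewrite -poweR_Lnorm// -powR_mulrn// -poweR_EFin.
by apply: gt0_ler_poweR => //; rewrite in_itv /= leey andbT ?Lnorm_ge0.
Qed.

End BlowUp.

Theorem theorem1p2 (R : realType) :
  exists (V : nat -> R * R -> 'rV[R]_2) (C : R),
    [/\ (forall n (i : 'I_2), Cinf_cdisc (fun z => V n z 0 i)),
        (forall n, (lorentz21 (fun z => enorm (jacobian2 (V n) z)) <= C%:E)%E)
      & forall u : nat -> R * R -> R,
          (forall n, neumann_solution (fun z => \det (jacobian2 (V n) z)) (u n)) ->
          Lp_disc +oo (u n) @[n --> \oo] --> +oo%E /\
          Lp_disc 2%:E (fun z => enorm (weak_grad (u n) z)) @[n --> \oo] --> +oo%E].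
Proof.
exists (fun n => bump (hpow n)), 32; split.
- by move=> n i k; apply: smooth_Ck_cdisc; exact: smooth_bump (hpow_gt0 n) i.
- exact: lorentz_bump.
move=> u un; split; apply/cvgeyPge => A.
- near=> n; rewrite leNgt; apply/negP => uA.
  have n5 : (5 < n)%N by near: n; exact: nbhs_infty_gt.
  have A0 : 0 <= A.
    by rewrite -lee_fin (le_trans _ (ltW uA))// /Lp_disc Lnorm_ge0.
  have := source_sup_bound n5 A0 (un n) (ltW uA).
  have : 108 * (A * 768 + 384) + 7 <= n%:R by near: n; exact: nbhs_infty_ger.
  lra.
- near=> n; rewrite leNgt; apply/negP => uA.
  have n5 : (5 < n)%N by near: n; exact: nbhs_infty_gt.
  have A0 : 0 <= A.
    by rewrite -lee_fin (le_trans _ (ltW uA))// /Lp_disc Lnorm_ge0.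
  have := source_energy_bound n5 (un n) (Lp_disc2_le A0 (ltW uA)).
  have : 216 * ((128 * 216) * A ^+ 2 + 384) + 14 <= n%:R by near: n; exact: nbhs_infty_ger.
  lra.
Unshelve. all: by end_near. Qed.
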